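(* Let $G$ be a $3$-dimensional unimodular (real) Lie group. Then there exists a left-invariant Riemannian metric $g$ on $G$ such that the index of symmetry of $(G,g)$ is positive, i.e. $i_{\mathfrak s}(G,g)\ge 1$.
   Context: Let $M$ be a homogeneous Riemannian manifold with Levi-Civita connection $\nabla$. For $p\in M$ put $$\mathfrak s_p=\{v\in T_pM:\ \text{there is a Killing field } X \text{ on } M \text{ with } X(p)=v \text{ and } (\nabla X)_p=0\}.$$ The index of symmetry $i_{\mathfrak s}(M)$ is $\dim \mathfrak s_p$, which by homogeneity does not depend on $p$. Equivalently, it is the largest $k$ such that there exist Killing fields $X_1,\dots,X_k$ with $X_1(p),\dots,X_k(p)$ linearly independent and $(\nabla X_1)_p=\cdots=(\nabla X_k)_p=0$. *)

(* Defs.v *)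
From HB Require Import structures.
From mathcomp Require Import all_boot all_order all_algebra.
From mathcomp Require Import all_classical all_reals all_analysis.

Set Implicit Arguments.
Unset Strict Implicit.
Unset Printing Implicit Defensive.

Import Order.TTheory GRing.Theory Num.Theory.
Import numFieldNormedType.Exports.

Local Open Scope classical_set_scope.
Local Open Scope ring_scope.

(** * Smooth maps between finite-dimensional normed spaces *)

(* Meant for an open set U and for V, W of finite dimension. The functions are
   total, but only their values on U matter, since differentiability and
   derivatives at a point of U depend only on a neighbourhood of that point. *)
Fixpoint Ck (R : realType) (V W : normedModType R) (k : nat)
    (U : set V) (f : V -> W) : Prop :=
  match k with
  | 0 => forall x, U x -> {for x, continuous f}
  | k'.+1 => (forall x, U x -> differentiable f x) /\
             (forall v, Ck k' U (fun x => 'D_v f x))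
  end.

Definition smooth_on (R : realType) (V W : normedModType R)
    (U : set V) (f : V -> W) : Prop := forall k, Ck k U f.

(** * Smooth manifolds and Lie groups *)

(* [cinv] is the inverse of [cmap] on its image; the values of [cmap] outside
   [cdom] and of [cinv] outside [cimg] are irrelevant. *)
Record chart (R : realType) (n : nat) (M : topologicalType) := Chart {
  cdom : set M;
  cmap : M -> 'rV[R]_n;
  cinv : 'rV[R]_n -> M;
  cdom_open : open cdom;
  cimg_open : open (cmap @` cdom);
  cmapK : forall p, cdom p -> cinv (cmap p) = p;
  cmap_continuous : forall p, cdom p -> {for p, continuous cmap};
  cinv_continuous : forall p, cdom p -> {for cmap p, continuous cinv} }.

Definition cimg (R : realType) n (M : topologicalType) (c : chart R n M) :
  set 'rV[R]_n := cmap c @` cdom c.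

(* The atlas need not be maximal. *)
Record manifold (R : realType) (n : nat) := Manifold {
  pts :> topologicalType;
  atlas : set (chart R n pts);
  manifold_hausdorff : hausdorff_space pts;
  manifold_second_countable : @second_countable pts;
  atlas_cover : forall p : pts, exists2 c, atlas c & cdom c p;
  atlas_smooth : forall c d, atlas c -> atlas d ->
    smooth_on (cmap c @` (cdom c `&` cdom d)) (cmap d \o cinv c) }.

Definition chart_at (R : realType) n (M : manifold R n)
  (c : chart R n M) (p : M) : Prop := atlas c /\ cdom c p.

Record lieGroup (R : realType) (n : nat) := LieGroup {
  lg_manifold :> manifold R n;
  lg_mul : lg_manifold -> lg_manifold -> lg_manifold;
  lg_inv : lg_manifold -> lg_manifold;
  lg_one : lg_manifold;
  lg_mulA : associative lg_mul;
  lg_mul1 : left_id lg_one lg_mul;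
  lg_mulV : left_inverse lg_one lg_inv lg_mul;
  lg_mul_continuous : continuous (fun ab => lg_mul ab.1 ab.2);
  lg_inv_continuous : continuous lg_inv;
  lg_mul_smooth : forall b c d : chart R n lg_manifold,
    atlas b -> atlas c -> atlas d ->
    smooth_on
      [set xy : 'rV[R]_n * 'rV[R]_n | [/\ cimg b xy.1, cimg c xy.2 &
         cdom d (lg_mul (cinv b xy.1) (cinv c xy.2))]]
      (fun xy => cmap d (lg_mul (cinv b xy.1) (cinv c xy.2)));
  lg_inv_smooth : forall c d : chart R n lg_manifold, atlas c -> atlas d ->
    smooth_on [set x | cimg c x /\ cdom d (lg_inv (cinv c x))]
      (cmap d \o lg_inv \o cinv c) }.

(** * Tensor fields *)

(* A tensor field is given by its components with respect to every chart:
   a value indexed by a chart [c] and a point [p], meaningful when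
   [chart_at c p], with the tensorial transformation law between charts. *)

(* Coordinate expression of the tangent map of F at p, from the chart c
   around p to the chart d around F p. For F = id this is the change of
   coordinates on the tangent space at p. *)
Definition tmap (R : realType) n (M : manifold R n) (F : M -> M)
    (c d : chart R n M) (p : M) (v : 'rV[R]_n) : 'rV[R]_n :=
  'd (cmap d \o F \o cinv c) (cmap c p) v.

Record vectorField (R : realType) (n : nat) (M : manifold R n) := VectorField {
  vf :> chart R n M -> M -> 'rV[R]_n;
  vf_change : forall c d p, chart_at c p -> chart_at d p ->
    vf d p = tmap id c d p (vf c p);
  vf_smooth : forall c, atlas c -> smooth_on (cimg c) (vf c \o cinv c) }.

Definition bilin (R : realType) n (B : 'M[R]_n) (u v : 'rV[R]_n) : R :=
  (u *m B *m v^T) 0 0.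

(* F^* g = g *)
Definition preserves_form (R : realType) n (M : manifold R n)
    (g : chart R n M -> M -> 'M[R]_n) (F : M -> M) : Prop :=
  forall c d p, chart_at c p -> chart_at d (F p) -> forall u v,
    bilin (g d (F p)) (tmap F c d p u) (tmap F c d p v) = bilin (g c p) u v.

Record riemannianMetric (R : realType) (n : nat) (M : manifold R n) :=
  RiemannianMetric {
  rm :> chart R n M -> M -> 'M[R]_n;
  rm_sym : forall c p, chart_at c p -> (rm c p)^T = rm c p;
  rm_posdef : forall c p, chart_at c p ->
    forall v, v != 0 -> 0 < bilin (rm c p) v v;
  rm_change : preserves_form rm id;
  rm_smooth : forall c, atlas c -> smooth_on (cimg c) (rm c \o cinv c) }.

(* F^* rho = rho, for the density rho |dx^1 ... dx^n| *)
Definition preserves_density (R : realType) n (M : manifold R n)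
    (rho : chart R n M -> M -> R) (F : M -> M) : Prop :=
  forall c d p, chart_at c p -> chart_at d (F p) ->
    rho d (F p) * `|\det ('J (cmap d \o F \o cinv c) (cmap c p))| = rho c p.

(* A positive smooth density, i.e. a smooth positive measure. *)
Record density (R : realType) (n : nat) (M : manifold R n) := Density {
  dens :> chart R n M -> M -> R;
  dens_pos : forall c p, chart_at c p -> 0 < dens c p;
  dens_change : preserves_density dens id;
  dens_smooth : forall c, atlas c ->
    smooth_on (cimg c) (fun x => dens c (cinv c x) : R^o) }.

(** * Killing fields and the Levi-Civita connection *)

(* Partial derivative at p of a function f in the i-th coordinate of c. *)
Definition pd (R : realType) n (M : manifold R n) (c : chart R n M)
    (i : 'I_n) (f : M -> R) (p : M) : R :=
  'D_(delta_mx 0 i) (fun x => f (cinv c x) : R^o) (cmap c p).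

(* L_X g = 0, where (L_X g)_ij = X^k d_k g_ij + g_kj d_i X^k + g_ik d_j X^k *)
Definition killing (R : realType) n (M : manifold R n)
    (g : riemannianMetric M) (X : vectorField M) : Prop :=
  forall c p, chart_at c p -> forall i j : 'I_n,
    \sum_k (X c p 0 k * pd c k (fun q => g c q i j) p
            + g c p k j * pd c i (fun q => X c q 0 k) p
            + g c p i k * pd c j (fun q => X c q 0 k) p) = 0.

(* Gamma^k_ij *)
Definition christoffel (R : realType) n (M : manifold R n)
    (g : riemannianMetric M) (c : chart R n M) (p : M) (k i j : 'I_n) : R :=
  2^-1 * \sum_l invmx (g c p) k l *
    (pd c i (fun q => g c q j l) p + pd c j (fun q => g c q i l) p
     - pd c l (fun q => g c q i j) p).

(* Component k of nabla_(d_i) X for the Levi-Civita connection nabla of g. *)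
Definition nabla (R : realType) n (M : manifold R n)
    (g : riemannianMetric M) (X : vectorField M)
    (c : chart R n M) (p : M) (i k : 'I_n) : R :=
  pd c i (fun q => X c q 0 k) p + \sum_j christoffel g c p k i j * X c p 0 j.

(** * The index of symmetry *)

(* The subspace s_p of the tangent space at p, in the coordinates of c. *)
Definition sym_space (R : realType) n (M : manifold R n)
    (g : riemannianMetric M) (c : chart R n M) (p : M) : set 'rV[R]_n :=
  [set v | exists X : vectorField M,
     [/\ killing g X, X c p = v & forall i k, nabla g X c p i k = 0]].

(* The dimension of s_p, as the largest size of a linearly independent family;
   it does not depend on the chart used to compute it. *)
Definition symmetry_index (R : realType) n (M : manifold R n)
    (g : riemannianMetric M) (p : M) : nat :=
  (\max_(k < n.+1 | `[< exists c, chart_at c p /\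
     exists2 A : 'M[R]_(k, n), row_free A &
       forall i, sym_space g c p (row i A) >]) k)%N.

(** * Invariance on Lie groups *)

Definition left_invariant_metric (R : realType) n (G : lieGroup R n)
    (g : riemannianMetric G) : Prop :=
  forall a : G, preserves_form g (lg_mul a).

(* The left Haar measures of a Lie group are the left-invariant positive
   smooth densities, unique up to a constant factor; G is unimodular when
   they are also right-invariant. *)
Definition unimodular (R : realType) n (G : lieGroup R n) : Prop :=
  exists rho : density G, forall a : G,
    preserves_density rho (lg_mul a) /\
    preserves_density rho (fun b => lg_mul b a).

(* Main.v *)
(** Let [E_i] be a left-invariant frame. A right-invariant field [Y] commutes with
    every [E_i], so it is Killing for every left-invariant metric; its components
    [b] in the frame satisfy [E_j b = [b, e_j]] and are entries of [Ad (p^-1)]. For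
    a Killing field the covariant derivative at [p] is half the exterior derivative
    of the dual form, so it is algebraic in [b p] and the structure constants.

    Unimodularity means [tr ad = 0]; in dimension 3 the bracket is then
    [[u, v] = (u x v) L] with [L] symmetric, and diagonalizing [L] by congruence
    gives a basis with [[e_1, e_2] = l0 e_0], [[e_2, e_0] = l1 e_1],
    [[e_0, e_1] = l2 e_2] (Milnor). For the metric [diag (t0, t1, t2)] in this basis,
    the right-invariant field equal to [e_0] at [p] is parallel there iff
    [l0 t0 = l1 t1 + l2 t2]. Up to rotating the indices, positive [t_i] with this
    property exist unless exactly one [l_i] is nonzero, the Heisenberg algebra. In
    that case one adds to the central field a multiple of the rotation around it.
    The rotation field is a polynomial in two functions read off from [Ad], so the
    argument needs neither an integration nor connectedness of the group. *)

Require Import Defs.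
From HB Require Import structures.
From mathcomp Require Import all_boot all_order all_algebra.
From mathcomp Require Import all_classical all_reals all_analysis.
From mathcomp Require Import perm ring lra.

Set Implicit Arguments.
Unset Strict Implicit.
Unset Printing Implicit Defensive.

Import Order.TTheory GRing.Theory Num.Theory.
Import numFieldNormedType.Exports.

Local Open Scope classical_set_scope.
Local Open Scope ring_scope.

(** * Closure properties of [Ck] and matrix-valued derivatives *)

Section Calculus.
Context {R : realType}.
Implicit Types V W : normedModType R.

(** The little-o expansion of [f] at [x] is also one of [g], and an expansion with a continuous
    linear part determines the differential. *)
Lemma near_eq_differentiable V W (f g : V -> W) (x : V) :
  (\near x, f x = g x) -> differentiable f x -> differentiable g x.
Proof.
move=> fg df.
have E : g \o shift x = cst (g x) + 'd f x +o_ (0 : V) id.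
  apply/eqaddoP => e e0.
  have := diff_locally df; move/eqaddoP => /(_ e e0) H.
  have fgx : f x = g x by exact: nbhs_singleton fg.
  have fg0 : \forall h \near (0 : V), f (h + x) = g (h + x).
    move: fg; rewrite (near_shift 0) /=; apply: filterS => h.
    by rewrite /= subr0.
  near=> h.
  have -> : (g \o shift x - (cst (g x) + 'd f x)) h = (f \o shift x - (cst (f x) + 'd f x)) h.
    by rewrite !fctE /= fgx; congr (_ - _); rewrite -(near fg0 h).
  by near: h.
have E' := @diff_unique _ _ _ g ('d f x) x (diff_continuous df) E.
apply/diff_locallyP; split.
  by rewrite E'; exact: diff_continuous.
by rewrite E' E.
Unshelve. all: by end_near. Qed.

Lemma Ck_pred V W k (U : set V) (f : V -> W) : Ck k.+1 U f -> Ck k U f.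
Proof.
elim: k f => [|k IH] f; first by case=> df _ x Ux; apply: differentiable_continuous; exact: df.
by case=> df Df; split=> // v; apply: IH; exact: Df.
Qed.

(** The usual derivative formulas are known only at points of [U]; this lets inductions on [k]
    replace a derivative by its formula there. Openness of [U] makes the derivatives of [f] and [g]
    agree as well. *)
Lemma Ck_ext V W k (U : set V) (f g : V -> W) : open U ->
  (forall x, U x -> f x = g x) -> Ck k U f -> Ck k U g.
Proof.
move=> oU; elim: k f g => [|k IH] f g fg.
  move=> cf x Ux; have Unear : \near x, f x = g x.
    by near=> y; apply: fg; near: y; exact: open_nbhs_nbhs.
  have cfx : f y @[y --> x] --> g x by rewrite -(fg x Ux); exact: cf.
  by apply: cvg_trans cfx; apply: near_eq_cvg; near=> y; rewrite (near Unear y).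
case=> df Df; have Unear x : U x -> \near x, f x = g x.
  by move=> Ux; near=> y; apply: fg; near: y; exact: open_nbhs_nbhs.
split=> [x Ux|v]; first by apply: near_eq_differentiable (df x Ux); exact: Unear.
by apply: IH (Df v) => x Ux; apply: near_eq_derive; exact: Unear.
Unshelve. all: by end_near. Qed.

Lemma Ck_cst V W k (U : set V) (a : W) : Ck k U (fun _ : V => a).
Proof.
elim: k a => [|k IH] a; first by move=> x _; exact: cvg_cst.
split=> [x _|v]; first exact: differentiable_cst.
have -> : (fun x => 'D_v (fun _ : V => a) x) = fun=> 0.
  by apply/funext => x; exact: derive_cst.
exact: IH.
Qed.

Lemma Ck_add V W k (U : set V) (f g : V -> W) : open U ->
  Ck k U f -> Ck k U g -> Ck k U (fun x => f x + g x).
Proof.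
move=> oU; elim: k f g => [|k IH] f g.
  by move=> cf cg x Ux; apply: cvgD; [exact: cf|exact: cg].
case=> df Df [dg Dg]; split=> [x Ux|v].
  by apply: differentiableD; [exact: df|exact: dg].
apply: (Ck_ext oU _ (IH _ _ (Df v) (Dg v))) => x Ux.
by rewrite deriveD//; apply: diff_derivable; [exact: df|exact: dg].
Qed.

Lemma Ck_sum V W k (U : set V) (I : Type) (r : seq I) (P : pred I) (f : I -> V -> W) : open U ->
  (forall i, P i -> Ck k U (f i)) -> Ck k U (fun x => \sum_(i <- r | P i) f i x).
Proof.
move=> oU cf; elim: r => [|i r IH].
  rewrite (_ : (fun x => _) = fun=> 0); first exact: Ck_cst.
  by apply/funext => x; rewrite big_nil.
case: (boolP (P i)) => Pi.
  rewrite (_ : (fun x => _) = fun x => f i x + \sum_(i <- r | P i) f i x).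
    by apply: Ck_add => //; exact: cf.
  by apply/funext => x; rewrite big_cons Pi.
by under eq_fun do rewrite big_cons (negbTE Pi).
Qed.

Lemma Ck_scaler V W k (U : set V) (f : V -> R^o) (w : W) : open U ->
  Ck k U f -> Ck k U (fun x => f x *: w).
Proof.
move=> oU; elim: k f => [|k IH] f.
  by move=> cf x Ux; apply: cvgZr_tmp; exact: cf.
case=> df Df; split=> [x Ux|v]; first by apply: differentiableZl; exact: df.
apply: (Ck_ext oU _ (IH _ (Df v))) => x Ux.
have dfx := df x Ux.
rewrite (deriveE _ (differentiableZl _ dfx)) (diffZl _ dfx).
by rewrite deriveE.
Qed.

Lemma Ck_mul V k (U : set V) (f g : V -> R^o) : open U ->
  Ck k U f -> Ck k U g -> Ck k U (fun x => f x * g x : R^o).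
Proof.
move=> oU; elim: k f g => [|k IH] f g.
  by move=> cf cg x Ux; apply: cvgM; [exact: cf|exact: cg].
move=> Cf Cg; have [df Df] := Cf; have [dg Dg] := Cg.
split=> [x Ux|v]; first by apply: differentiableM; [exact: df|exact: dg].
apply: (Ck_ext oU _ (Ck_add oU (IH _ _ (Ck_pred Cf) (Dg v)) (IH _ _ (Ck_pred Cg) (Df v)))) => x Ux.
by rewrite deriveM//; apply: diff_derivable; [exact: df|exact: dg].
Qed.

Lemma Ck_prod V k (U : set V) (I : Type) (r : seq I) (P : pred I) (f : I -> V -> R^o) : open U ->
  (forall i, P i -> Ck k U (f i)) -> Ck k U (fun x => \prod_(i <- r | P i) f i x : R^o).
Proof.
move=> oU cf; elim: r => [|i r IH].
  rewrite (_ : (fun x => _) = fun=> 1 : R^o); first exact: Ck_cst.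
  by apply/funext => x; rewrite big_nil.
case: (boolP (P i)) => Pi.
  rewrite (_ : (fun x => _) = fun x => f i x * (\prod_(i <- r | P i) f i x : R^o)).
    by apply: Ck_mul => //; exact: cf.
  by apply/funext => x; rewrite big_cons Pi.
by under eq_fun do rewrite big_cons (negbTE Pi).
Qed.

Lemma Ck_inv V k (U : set V) (f : V -> R^o) : open U ->
  (forall x, U x -> f x != 0) -> Ck k U f -> Ck k U (fun x => (f x)^-1 : R^o).
Proof.
move=> oU f0; elim: k f f0 => [|k IH] f f0.
  by move=> cf x Ux; apply: cvgV; [exact: f0|exact: cf].
move=> Cf; have [df Df] := Cf.
split=> [x Ux|v]; first by apply: differentiableV; [exact: df|exact: f0].
have Ci := IH _ f0 (Ck_pred Cf).
apply: (Ck_ext oU _ (Ck_mul oU (Ck_cst _ U (-1 : R^o)) (Ck_mul oU (Ck_mul oU Ci Ci) (Df v)))) => x Ux.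
rewrite deriveV ?f0//; last by apply: diff_derivable; exact: df.
by rewrite mulN1r scaleNr expr2 invfM.
Qed.

Lemma Ck_mx V k (U : set V) m n (F : V -> 'M[R]_(m, n)) : open U ->
  (forall i j, Ck k U (fun x => F x i j : R^o)) -> Ck k U F.
Proof.
move=> oU CF.
rewrite (_ : F = fun x => \sum_i \sum_j F x i j *: delta_mx i j).
  by do 2 (apply: Ck_sum => // ? _); apply: Ck_scaler.
by apply/funext => x; exact: matrix_sum_delta.
Qed.

Lemma Ck_coord V k (U : set V) m n (F : V -> 'M[R]_(m, n)) i j : open U ->
  Ck k U F -> Ck k U (fun x => F x i j : R^o).
Proof.
move=> oU; elim: k F => [|k IH] F.
  move=> cF x Ux; apply: (@continuous_comp _ _ _ F (fun A : 'M[R]_(m, n) => A i j)).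
    exact: cF.
  exact: coord_continuous.
case=> dF DF; split=> [x Ux|v].
  apply: (@differentiable_comp _ _ _ _ F (fun A : 'M[R]_(m, n) => A i j : R^o)).
    exact: dF.
  exact: differentiable_coord.
apply: (Ck_ext oU _ (IH _ (DF v))) => x Ux.
by rewrite derive_mx ?mxE//; apply: diff_derivable; exact: dF.
Qed.

Lemma derive_comp_diff V (V' : normedModType R) W (A l : V -> V') (f : V' -> W) x v :
  is_diff x A l -> differentiable f (A x) ->
  'D_v (fun y => f (A y)) x = 'D_(l v) f (A x).
Proof.
move=> [dA Al] df.
rewrite (deriveE _ (differentiable_comp dA df)) (deriveE _ df).
by rewrite (diff_comp dA df) /= Al.
Qed.

(** Since [A] has the same differential [l] everywhere, the derivative of the composite along [v] is
    the derivative of [f] along the fixed vector [l v], composed with [A], and the induction closes.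
    It is applied to slices such as [y |-> (x, y)] of the group multiplication. *)
Lemma Ck_comp_affine V (V' : normedModType R) W k (U : set V) (U' : set V') (A l : V -> V') (f : V' -> W) :
  open U -> (forall x, is_diff x A l) -> (forall x, U x -> U' (A x)) ->
  Ck k U' f -> Ck k U (fun x => f (A x)).
Proof.
move=> oU dA UU'; elim: k f => [|k IH] f.
  move=> cf x Ux; apply: (@continuous_comp _ _ _ A f); last exact: cf (UU' _ Ux).
  by apply: differentiable_continuous; have [] := dA x.
case=> df Df; split=> [x Ux|v].
  by apply: (@differentiable_comp _ _ _ _ A f); [have [] := dA x|exact: df (UU' _ Ux)].
apply: (Ck_ext oU _ (IH _ (Df (l v)))) => x Ux.
by rewrite (derive_comp_diff _ (dA x)) //; exact: df (UU' _ Ux).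
Qed.

End Calculus.

(** * Symmetry of mixed second derivatives *)

Section Schwarz.
Context {R : realType} {V : normedModType R}.

(* The mean value theorem is applied to [s |-> f (x + s u + t v) - f (x + s u)]. *)
Lemma second_difference (f : V -> R^o) (x u v : V) (e : R) : 0 < e ->
  (\near x, differentiable f x) -> differentiable ('D_u f) x ->
  \forall t \near (0 : R)^'+,
   `|f (x + t *: u + t *: v) - f (x + t *: u) - f (x + t *: v) + f x
     - t ^+ 2 * 'D_v ('D_u f) x| <= e * t ^+ 2.
Proof.
move=> e0 df dh; set h := 'D_u f.
pose M : R := `|u| + `|v| + 1.
have M0 : 0 < M by rewrite /M ltr_wpDl // addr_ge0.
(* Two first-order errors, each at most [e / (2 * M)] times [t * M], will add up to [e * t]. *)
have e'0 : 0 < e / (2 * M) by rewrite divr_gt0 // mulr_gt0.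
have [d /= d0 Hd] : exists2 d, 0 < d & forall w, `|w| < d ->
    `|h (x + w) - h x - 'd h x w| <= e / (2 * M) * `|w|.
  have := diff_locally dh; move/eqaddoP => /(_ _ e'0) /nbhs_ballP[d /= d0 H].
  exists d => // w wd; have := H w; rewrite -ball_normE /= sub0r normrN => /(_ wd).
  by rewrite !fctE /= opprD addrA [w + x]addrC.
have [r /= r0 Hr] : exists2 r, 0 < r & forall w, `|w| < r -> differentiable f (x + w).
  move/nbhs_ballP : df => [r /= r0 H]; exists r => // w wr; apply: H.
  by rewrite -ball_normE /= opprD addrA subrr sub0r normrN.
near=> t.
have t0 : 0 < t by near: t; exact: nbhs_right_gt.
have tMd : t * M < d by rewrite -ltr_pdivlMr //; near: t; apply: nbhs_right_lt; rewrite divr_gt0.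
have tMr : t * M < r by rewrite -ltr_pdivlMr //; near: t; apply: nbhs_right_lt; rewrite divr_gt0.
(* The boolean switches the summand [t *: v] on or off, so that one bound serves both paths. *)
have nb s (b : bool) : 0 <= s <= t -> `|s *: u + (t *+ b) *: v| <= t * M.
  move=> /andP[s0 st]; apply: le_trans (ler_normD _ _) _; rewrite !normrZ ger0_norm //.
  have -> : `|t *+ b| = t *+ b by case: b => //=; rewrite ?normr0 // gtr0_norm.
  have : s * `|u| <= t * `|u| by exact: ler_wpM2r.
  have : t *+ b * `|v| <= t * `|v| by case: b => //=; rewrite mulr0n mul0r mulr_ge0 // ltW.
  by rewrite /M !mulrDr mulr1; move: t0; clear; lra.
pose phi (s : R) : R := f (x + (s *: u + t *: v)) - f (x + s *: u).
pose dphi (s : R) : R := h (x + (s *: u + t *: v)) - h (x + s *: u).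
have dpath (w : V) (s : R) : is_diff s (fun s : R => x + (s *: u + w)) ( *:%R ^~ u).
  have := is_diffD (is_diff_cst x s) (is_diffD (is_diff_scalel s u) (is_diff_cst w s)).
  by rewrite add0r addr0.
have is_d (w : V) (s : R) : differentiable f (x + (s *: u + w)) ->
  is_derive s 1 (fun s : R => f (x + (s *: u + w))) (h (x + (s *: u + w))).
  move=> dfw; have D := dpath w s; split.
    apply: diff_derivable.
    by apply: (@differentiable_comp _ _ _ _ (fun s : R => x + (s *: u + w)) f).
  by rewrite (derive_comp_diff _ D dfw) scale1r.
have dphiP s : 0 <= s <= t -> is_derive s 1 phi (dphi s).
  move=> st; apply: is_deriveB.
    by apply: is_d; apply: Hr; apply: le_lt_trans (nb s true st) tMr.
  have := @is_d 0 s; rewrite addr0; under eq_fun do rewrite addr0.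
  by apply; apply: Hr; have := nb s false st; rewrite mulr0n scale0r addr0 => /le_lt_trans; exact.
have [c ct mvt] : exists2 c, c \in `]0, t[ & phi t - phi 0 = dphi c * (t - 0).
  apply: MVT => // [s|].
    by rewrite in_itv /= => /andP[s0 st]; apply: dphiP; rewrite !ltW.
  apply: derivable_within_continuous => s; rewrite in_itv /= => st.
  by have [] := dphiP s st.
move: ct; rewrite in_itv /= => /andP[c0 ct].
have ct' : 0 <= c <= t by rewrite !ltW.
have w1 := nb c true ct'; have w2 := nb c false ct'.
rewrite mulr1n in w1; rewrite mulr0n scale0r addr0 in w2.
have H1 := le_trans (Hd _ (le_lt_trans w1 tMd)) (ler_wpM2l (ltW e'0) w1).
have H2 := le_trans (Hd _ (le_lt_trans w2 tMd)) (ler_wpM2l (ltW e'0) w2).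
have -> : f (x + t *: u + t *: v) - f (x + t *: u) - f (x + t *: v) + f x = t * dphi c.
  move: mvt; rewrite /phi subr0 scale0r add0r addr0 addrA mulrC => <-.
  ring.
rewrite (deriveE _ dh).
have -> : t * dphi c - t ^+ 2 * 'd h x v = 
   t * ((h (x + (c *: u + t *: v)) - h x - 'd h x (c *: u + t *: v)) - (h (x + c *: u) - h x - 'd h x (c *: u))).
  have Lt : 'd h x (t *: v) = t * 'd h x v by exact: linearZ.
  by rewrite linearD Lt /dphi; ring.
rewrite normrM gtr0_norm // expr2 mulrCA ler_pM2l //.
apply: le_trans (ler_normB _ _) _.
apply: le_trans (lerD H1 H2) _.
by rewrite le_eqVlt; apply/orP; left; apply/eqP; field; rewrite gt_eqF.
Unshelve. all: by end_near. Qed.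

(** The second difference is symmetric in [u] and [v], and both mixed derivatives times [t ^+ 2]
    approximate it up to [e / 2 * t ^+ 2]; divide by [t ^+ 2]. *)
Lemma schwarz (f : V -> R^o) (x u v : V) :
  (\near x, differentiable f x) -> differentiable ('D_u f) x -> differentiable ('D_v f) x ->
  'D_u ('D_v f) x = 'D_v ('D_u f) x.
Proof.
move=> df du dv; apply/eqP; rewrite -subr_eq0 -normr_le0.
apply/ler_addgt0Pl => e e0; rewrite addr0.
have e2 : 0 < e / 2 by rewrite divr_gt0.
have H1 := second_difference v e2 df du.
have H2 := second_difference u e2 df dv.
suff : \forall t \near (0 : R)^'+, `|'D_u ('D_v f) x - 'D_v ('D_u f) x| <= e.
  by move=> H; near (0 : R)^'+ => t; near: t.
apply: filterS3 H1 H2 (nbhs_right_gt 0) => t K1 K2 t0.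
have t20 : 0 < t ^+ 2 by rewrite exprn_gt0.
rewrite -(ler_pM2r t20) -[X in _ * X <= _](gtr0_norm t20) -normrM.
set D1 := 'D_v ('D_u f) x in K1 *; set D2 := 'D_u ('D_v f) x in K2 *.
set A := f (x + t *: u + t *: v) in K1; have EA : f (x + t *: v + t *: u) = A by rewrite addrAC.
rewrite EA in K2.
have -> : (D2 - D1) * t ^+ 2 = (A - f (x + t *: u) - f (x + t *: v) + f x - t ^+ 2 * D1)
  - (A - f (x + t *: v) - f (x + t *: u) + f x - t ^+ 2 * D2) by ring.
apply: le_trans (ler_normB _ _) _.
apply: le_trans (lerD K1 K2) _ => //.
by rewrite -mulrDl -splitr.
Unshelve. all: by end_near. Qed.

End Schwarz.

(** * Smoothness and product rules for matrix-valued maps *)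

Section MatrixCalculus.
Context {R : realType}.
Implicit Types V : normedModType R.

Lemma Ck_mulmx V k (U : set V) m n p (F : V -> 'M[R]_(m, n)) (H : V -> 'M[R]_(n, p)) :
  open U -> Ck k U F -> Ck k U H -> Ck k U (fun x => F x *m H x).
Proof.
move=> oU cF cH; apply: Ck_mx => // i j.
under eq_fun do rewrite mxE.
apply: (@Ck_sum _ _ R^o _ _ _ _ _ (fun l x => F x i l * H x l j)) => // l _.
by apply: (Ck_mul oU); exact: Ck_coord.
Qed.

Lemma Ck_trmx V k (U : set V) m n (F : V -> 'M[R]_(m, n)) :
  open U -> Ck k U F -> Ck k U (fun x => (F x)^T).
Proof.
by move=> oU cF; apply: Ck_mx => // i j; under eq_fun do rewrite mxE; exact: Ck_coord.
Qed.

Lemma Ck_det V k (U : set V) n (F : V -> 'M[R]_n) :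
  open U -> Ck k U F -> Ck k U (fun x => \det (F x) : R^o).
Proof.
move=> oU cF; apply: (@Ck_sum _ _ R^o _ _ _ _ _ (fun (s : 'S_n) x => (-1) ^+ s * \prod_i F x i (s i))) => // s _.
apply: (Ck_mul oU); first exact: Ck_cst.
by apply: (@Ck_prod _ _ _ _ _ _ _ (fun i x => F x i (s i))) => // i _; exact: Ck_coord.
Qed.

Lemma Ck_invmx V k (U : set V) n (F : V -> 'M[R]_n) :
  open U -> (forall x, U x -> F x \in unitmx) ->
  Ck k U F -> Ck k U (fun x => invmx (F x)).
Proof.
move=> oU uF cF.
apply: (@Ck_ext _ _ _ _ _ (fun x => (\det (F x))^-1 *: \adj (F x))) => //.
  by move=> x /uF uFx; rewrite /invmx uFx.
have cdet : Ck k U (fun x => (\det (F x))^-1 : R^o).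
  apply: Ck_inv => //; last exact: Ck_det.
  by move=> x /uF; rewrite unitmxE unitfE.
apply: Ck_mx => // i j; under eq_fun do rewrite !mxE.
apply: (Ck_mul oU) => //; rewrite /cofactor; apply: (Ck_mul oU); first exact: Ck_cst.
apply: (Ck_det oU); apply: Ck_mx => // a b; under eq_fun do rewrite !mxE.
exact: Ck_coord.
Qed.

Lemma differentiable_mxP V m n (F : V -> 'M[R]_(m, n)) x :
  differentiable F x <-> forall i j, differentiable (fun y => F y i j : R^o) x.
Proof.
split=> [dF i j|dF].
  apply: (@differentiable_comp _ _ _ _ F (fun A : 'M[R]_(m, n) => A i j : R^o)) => //.
  exact: differentiable_coord.
rewrite (_ : F = \sum_i \sum_j (fun x => F x i j *: delta_mx i j)).
  by apply: differentiable_sum => i; apply: differentiable_sum => j; apply: differentiableZl.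
by apply/funext => y; rewrite fct_sumE [LHS]matrix_sum_delta; apply: eq_bigr => i _; rewrite fct_sumE.
Qed.

Lemma derive_coord V m n (F : V -> 'M[R]_(m, n)) x v i j : differentiable F x ->
  ('D_v F x) i j = 'D_v (fun y => F y i j : R^o) x.
Proof. by move=> dF; rewrite derive_mx ?mxE //; exact: diff_derivable. Qed.

Lemma differentiable_mulmx V m n p (F : V -> 'M[R]_(m, n)) (H : V -> 'M[R]_(n, p)) x :
  differentiable F x -> differentiable H x -> differentiable (fun y => F y *m H y) x.
Proof.
move=> /differentiable_mxP dF /differentiable_mxP dH; apply/differentiable_mxP => i j.
rewrite (_ : (fun y => _) = \sum_k (fun y => F y i k * H y k j)).
  by apply: differentiable_sum => k; apply: differentiableM.
by apply/funext => y; rewrite fct_sumE mxE.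
Qed.

Lemma derive_mulmx V m n p (F : V -> 'M[R]_(m, n)) (H : V -> 'M[R]_(n, p)) x v :
  differentiable F x -> differentiable H x ->
  'D_v (fun y => F y *m H y) x = 'D_v F x *m H x + F x *m 'D_v H x.
Proof.
move=> dF dH; have dFH := differentiable_mulmx dF dH.
have dF' := (differentiable_mxP _ _).1 dF; have dH' := (differentiable_mxP _ _).1 dH.
apply/matrixP => i j; rewrite derive_coord // !mxE.
rewrite (_ : (fun y => _) = \sum_k (fun y => F y i k * H y k j)); last first.
  by apply/funext => y; rewrite fct_sumE mxE.
rewrite derive_sum; last by move=> k; apply: diff_derivable; apply: differentiableM.
rewrite -big_split /=; apply: eq_bigr => k _.
rewrite deriveM; [|exact: diff_derivable|exact: diff_derivable].
rewrite !derive_coord // addrC; congr (_ + _); exact: mulrC.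
Qed.

Lemma derive_mulmxl V m n p (A : 'M[R]_(m, n)) (H : V -> 'M[R]_(n, p)) x v :
  differentiable H x -> 'D_v (fun y => A *m H y) x = A *m 'D_v H x.
Proof.
move=> dH; rewrite (@derive_mulmx _ _ _ _ (fun=> A)) //.
by rewrite (derive_cst A) mul0mx add0r.
Qed.

Lemma differentiable_mulmxl V m n p (A : 'M[R]_(m, n)) (H : V -> 'M[R]_(n, p)) x :
  differentiable H x -> differentiable (fun y => A *m H y) x.
Proof. by move=> dH; apply: (@differentiable_mulmx _ _ _ _ (fun=> A)). Qed.

Lemma derive_mulmxr V m n p (A : 'M[R]_(n, p)) (H : V -> 'M[R]_(m, n)) x v :
  differentiable H x -> 'D_v (fun y => H y *m A) x = 'D_v H x *m A.
Proof.
move=> dH; rewrite (@derive_mulmx _ _ _ _ _ (fun=> A)) //.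
by rewrite (derive_cst A) mulmx0 addr0.
Qed.

Lemma derive_row V m n (F : V -> 'M[R]_(m, n)) x v i :
  differentiable F x -> 'D_v (fun y => row i (F y)) x = row i ('D_v F x).
Proof. by move=> dF; under eq_fun do rewrite rowE; rewrite derive_mulmxl // rowE. Qed.

Lemma derive_trmx V m n (F : V -> 'M[R]_(m, n)) x v :
  differentiable F x -> 'D_v (fun y => (F y)^T) x = ('D_v F x)^T.
Proof.
move=> dF; have dFT : differentiable (fun y => (F y)^T) x.
  apply/differentiable_mxP => i j; under eq_fun do rewrite mxE.
  by move: i j => j i; move: i j; exact/differentiable_mxP.
apply/matrixP => i j; rewrite derive_coord // mxE derive_coord //.
by under eq_fun do rewrite mxE.
Qed.

Lemma derive_dir_sum V m n (F : V -> 'M[R]_(m, n)) x (I : finType) (v : I -> V) (a : I -> R) :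
  differentiable F x -> 'D_(\sum_i a i *: v i) F x = \sum_i a i *: 'D_(v i) F x.
Proof.
move=> dF; rewrite deriveE // linear_sum; apply: eq_bigr => i _.
by rewrite linearZ /= deriveE.
Qed.

Lemma derive_dir_delta n m p (F : 'rV[R]_n -> 'M[R]_(m, p)) x (v : 'rV[R]_n) :
  differentiable F x -> 'D_v F x = \sum_i v 0 i *: 'D_(delta_mx 0 i) F x.
Proof. by move=> dF; rewrite [in LHS](row_sum_delta v) derive_dir_sum. Qed.

Lemma Ck_schwarz V m n (U : set V) (F : V -> 'M[R]_(m, n)) x u v :
  open U -> U x -> Ck 2 U F -> 'D_u ('D_v F) x = 'D_v ('D_u F) x.
Proof.
move=> oU Ux CF; have [dF DF] := CF.
have dDF w : differentiable ('D_w F) x by have [+ _] := DF w; exact.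
have Unear : \forall y \near x, U y by exact: open_nbhs_nbhs.
apply/matrixP => i j.
apply: etrans (derive_coord u i j (dDF v)) _.
apply: etrans (esym (derive_coord v i j (dDF u))).
have E w : \forall y \near x, ('D_w F y) i j = 'D_w (fun z => F z i j : R^o) y.
  by apply: filterS Unear => y /dF dFy; rewrite derive_coord.
rewrite (near_eq_derive _ (E u)) (near_eq_derive _ (E v)).
have [_ DFij] := Ck_coord i j oU CF.
apply: schwarz.
- by apply: filterS Unear => y /dF /differentiable_mxP.
- by have [+ _] := DFij u; apply.
- by have [+ _] := DFij v; apply.
Qed.

End MatrixCalculus.

(** * Invariant frames and the adjoint representation *)

(** It acts on row vectors from the right, so the Jacobians of a composite multiply in the order in
    which the maps are applied. *)
HB.lock Definition jac (R : realType) n (M : manifold R n) (F : M -> M)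
  (c d : chart R n M) (p : M) : 'M[R]_n := 'J (cmap d \o F \o cinv c) (cmap c p).

(** * Coordinate expressions of maps and the chain rule *)

Section Charts.
Context {R : realType} {n : nat} {M : manifold R n}.
Implicit Types (c d e : chart R n M) (p q : M) (F : M -> M).

Lemma cimg_mem c p : cdom c p -> cimg c (cmap c p).
Proof. by move=> cp; exists p. Qed.

Lemma cinv_dom c x : cimg c x -> cdom c (cinv c x).
Proof. by case=> p cp <-; rewrite cmapK. Qed.

Lemma cinvK c x : cimg c x -> cmap c (cinv c x) = x.
Proof. by case=> p cp <-; rewrite cmapK. Qed.

Lemma chart_at_cinv c x : atlas c -> cimg c x -> chart_at c (cinv c x).
Proof. by move=> ac cx; split=> //; exact: cinv_dom. Qed.

Lemma open_cimg c : open (cimg c).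
Proof. exact: cimg_open. Qed.

Lemma cinv_cont c x : cimg c x -> {for x, continuous (cinv c)}.
Proof. by case=> p cp <-; exact: cinv_continuous. Qed.

Lemma open_preimage_cinv c F (O : set M) : open O -> continuous F ->
  open [set y | cimg c y /\ O (F (cinv c y))].
Proof.
move=> oO cF; rewrite openE => y [cy Oy]; rewrite /interior /=.
have H1 : nbhs y (cimg c) by apply: open_nbhs_nbhs; split=> //; exact: open_cimg.
have H2 : nbhs y [set y | O (F (cinv c y))].
  have H3 : nbhs (F (cinv c y)) O by exact: open_nbhs_nbhs.
  exact: (cinv_cont cy (cF _ _ H3)).
by apply: filterS2 H1 H2.
Qed.

Lemma tmapE F c d p v : tmap F c d p v = v *m jac F c d p.
Proof. by rewrite /tmap jac.unlock /jacobian mul_rV_lin1. Qed.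

Lemma jacE F c d p v : differentiable (cmap d \o F \o cinv c) (cmap c p) ->
  v *m jac F c d p = 'D_v (cmap d \o F \o cinv c) (cmap c p).
Proof. by move=> dF; rewrite -tmapE /tmap deriveE. Qed.

(** Continuity is asked separately because [cmap d] is arbitrary outside [cdom d]: differentiability
    of the coordinate expression does not by itself keep [F] near [p] inside that domain. *)
Definition diffmap F : Prop := continuous F /\
  forall c d p, chart_at c p -> chart_at d (F p) ->
    differentiable (cmap d \o F \o cinv c) (cmap c p).

(** An intermediate chart [d] can be inserted only where [cinv d \o cmap d] is the identity, that is
    on [cdom d]; continuity of [G] provides this near [p]. *)
Lemma near_cinv_comp F G c d p : continuous G -> cdom c p -> cdom d (G p) ->
  \forall y \near (cmap c p), forall e, (cmap e \o (F \o G) \o cinv c) y =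
   (cmap e \o F \o cinv d) ((cmap d \o G \o cinv c) y).
Proof.
move=> cG cp dGp; have := open_preimage_cinv (c := c) (cdom_open d) cG.
rewrite openE => /(_ (cmap c p)) /=.
have /[swap]/[apply] : cimg c (cmap c p) /\ cdom d (G (cinv c (cmap c p))).
  by rewrite cmapK //; split=> //; exact: cimg_mem.
by apply: filterS => y [cy dy] e /=; rewrite cmapK.
Qed.

Lemma diffmap_comp F G : diffmap F -> diffmap G -> diffmap (F \o G).
Proof.
move=> [cF dF] [cG dG]; split=> [p|c e p cp ep].
  by apply: continuous_comp; [exact: cG|exact: cF].
have [d ad dp] := @atlas_cover _ _ M (G p).
have := near_cinv_comp F cG cp.2 dp => nE.
apply: (@near_eq_differentiable _ _ _
  ((cmap e \o F \o cinv d) \o (cmap d \o G \o cinv c))).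
  by apply: filterS nE => y /(_ e) /= ->.
apply: differentiable_comp; first exact: dG.
rewrite /= cmapK; last exact: cp.2.
exact: dF.
Qed.

Lemma jac_comp F G c d e p : diffmap F -> diffmap G ->
  chart_at c p -> chart_at d (G p) -> chart_at e (F (G p)) ->
  jac (F \o G) c e p = jac G c d p *m jac F d e (G p).
Proof.
move=> dF dG cp dp ep.
have dGp := dG.2 _ _ _ cp dp; have dFp := dF.2 _ _ _ dp ep.
have dFG := (diffmap_comp dF dG).2 _ _ _ cp ep.
have EG : (cmap d \o G \o cinv c) (cmap c p) = cmap d (G p).
  by rewrite /= cmapK //; exact: cp.2.
have nE := near_cinv_comp F dG.1 cp.2 dp.2.
apply/row_matrixP => i; rewrite !rowE mulmxA.
set v := delta_mx 0 i; apply: etrans (jacE v dFG) _.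
have -> : v *m jac G c d p = 'D_v (cmap d \o G \o cinv c) (cmap c p) by exact: jacE.
apply: etrans (esym (jacE _ dFp)).
rewrite (@near_eq_derive _ _ _ _ ((cmap e \o F \o cinv d) \o (cmap d \o G \o cinv c))); last first.
  by apply: filterS nE => y /(_ e).
have dFp' : differentiable (cmap e \o F \o cinv d) ((cmap d \o G \o cinv c) (cmap c p)).
  by rewrite EG.
rewrite (derive_comp_diff _ (differentiableP dGp) dFp').
by rewrite EG -(deriveE _ dGp).
Qed.

Lemma near_cimg c p : cdom c p -> \forall y \near cmap c p, cimg c y.
Proof.
by move=> cp; apply: open_nbhs_nbhs; split; [exact: open_cimg|exact: cimg_mem].
Qed.

Lemma jac_id c p : chart_at c p -> jac id c c p = 1%:M.
Proof.
move=> [ac cp]; have nE : \forall y \near cmap c p, id y = (cmap c \o id \o cinv c) y.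
  by apply: filterS (near_cimg cp) => y /cinvK.
have did : differentiable (cmap c \o id \o cinv c) (cmap c p).
  by apply: near_eq_differentiable nE _.
apply/row_matrixP => i; rewrite !rowE mulmx1 (jacE _ did).
by rewrite -(near_eq_derive _ nE) derive_id.
Qed.

End Charts.

(** * Translations, invariant frames and the adjoint representation *)

Section LieGroup.
Context {R : realType} {n : nat} {G : lieGroup R n}.
Implicit Types (a b p q : G) (c d : chart R n G).
Local Notation "x ** y" := (lg_mul x y) (at level 40, left associativity).
Local Notation one := (lg_one G).

Lemma lg_mulgV a : a ** lg_inv a = one.
Proof.
rewrite -[a ** _]lg_mul1 -[X in X ** _](lg_mulV (lg_inv a)) -lg_mulA.
by rewrite [lg_inv a ** (_ ** _)]lg_mulA lg_mulV lg_mul1 lg_mulV.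
Qed.

Lemma lg_mulg1 a : a ** one = a.
Proof. by rewrite -(lg_mulV a) lg_mulA lg_mulgV lg_mul1. Qed.

Lemma lg_mulKg a b : a ** (lg_inv a ** b) = b.
Proof. by rewrite lg_mulA lg_mulgV lg_mul1. Qed.

Lemma lg_mulVKg a b : lg_inv a ** (a ** b) = b.
Proof. by rewrite lg_mulA lg_mulV lg_mul1. Qed.

Lemma lg_invM a b : lg_inv (a ** b) = lg_inv b ** lg_inv a.
Proof.
have E : (a ** b) ** (lg_inv b ** lg_inv a) = one by rewrite -lg_mulA lg_mulKg lg_mulgV.
by rewrite -[RHS](lg_mulVKg (a ** b)) E lg_mulg1.
Qed.

Definition rmul b a : G := a ** b.

Definition mulc (b c d : chart R n G) (xy : 'rV[R]_n * 'rV[R]_n) : 'rV[R]_n :=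
  cmap d (cinv b xy.1 ** cinv c xy.2).

Definition muldom (b c d : chart R n G) : set ('rV[R]_n * 'rV[R]_n) :=
  [set xy | [/\ cimg b xy.1, cimg c xy.2 & cdom d (cinv b xy.1 ** cinv c xy.2)]].

Lemma mulc_smooth (b c d : chart R n G) : atlas b -> atlas c -> atlas d ->
  smooth_on (muldom b c d) (mulc b c d).
Proof. exact: lg_mul_smooth. Qed.

Lemma open_muldom (b c d : chart R n G) : open (muldom b c d).
Proof.
rewrite openE => -[x y] [/= bx cy dxy]; rewrite /interior /=.
have Hb : nbhs (x, y) (fun xy : 'rV[R]_n * 'rV[R]_n => cimg b xy.1).
  apply: (@cvg_fst _ _ (nbhs x) (nbhs y) _ (cimg b)).
  by apply: open_nbhs_nbhs; split=> //; exact: open_cimg.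
have Hc : nbhs (x, y) (fun xy : 'rV[R]_n * 'rV[R]_n => cimg c xy.2).
  apply: (@cvg_snd _ _ (nbhs x) (nbhs y) _ (cimg c)).
  by apply: open_nbhs_nbhs; split=> //; exact: open_cimg.
have Hd : nbhs (x, y) (fun xy : 'rV[R]_n * 'rV[R]_n => cdom d (cinv b xy.1 ** cinv c xy.2)).
  have H3 : nbhs (cinv b x ** cinv c y) (cdom d).
    by apply: open_nbhs_nbhs; split=> //; exact: cdom_open.
  have := @lg_mul_continuous _ _ G (cinv b x, cinv c y) _ H3.
  case=> -[P Q] /= [nP nQ] PQ.
  exists ([set z | P (cinv b z)], [set z | Q (cinv c z)]) => /=.
    by split; [exact: (cinv_cont bx nP)|exact: (cinv_cont cy nQ)].
  by move=> [z w] /= [Pz Qw]; apply: (PQ (_, _)).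
by apply: filterS3 Hb Hc Hd => z; split.
Qed.

Lemma is_diff_pairl (x0 y : 'rV[R]_n) :
  is_diff y (fun y : 'rV[R]_n => (x0, y)) (fun y : 'rV[R]_n => (0 : 'rV[R]_n, y)).
Proof. exact: is_diff_pair. Qed.

Lemma is_diff_pairr (x y0 : 'rV[R]_n) :
  is_diff x (fun x : 'rV[R]_n => (x, y0)) (fun x : 'rV[R]_n => (x, 0 : 'rV[R]_n)).
Proof. exact: is_diff_pair. Qed.

Lemma lmul_continuous a : continuous (lg_mul a).
Proof.
move=> p; apply: (@continuous_comp _ _ _ (fun q : G => (a, q)) (fun ab : G * G => ab.1 ** ab.2)).
  by apply: cvg_pair => //; exact: cvg_cst.
exact: lg_mul_continuous.
Qed.

Lemma rmul_continuous a : continuous (rmul a).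
Proof.
move=> p; apply: (@continuous_comp _ _ _ (fun q : G => (q, a)) (fun ab : G * G => ab.1 ** ab.2)).
  by apply: cvg_pair => //; exact: cvg_cst.
exact: lg_mul_continuous.
Qed.

(** Smoothness is given jointly in both factors; translation by [a] is the slice through the
    coordinates of [a] in a chart around it. *)
Lemma lmul_smooth a c d : atlas c -> atlas d ->
  smooth_on [set y | cimg c y /\ cdom d (a ** cinv c y)] (cmap d \o lg_mul a \o cinv c).
Proof.
move=> ac ad k; have [b ab ba] := @atlas_cover _ _ G a.
have := Ck_comp_affine _ (is_diff_pairl (cmap b a)) _ (mulc_smooth ab ac ad k).
move=> /(_ [set y | cimg c y /\ cdom d (a ** cinv c y)]).
rewrite (_ : (fun x => _) = cmap d \o lg_mul a \o cinv c); last first.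
  by apply/funext => y /=; rewrite /mulc /= cmapK.
apply; first by apply: open_preimage_cinv; [exact: cdom_open|exact: lmul_continuous].
by move=> y [cy dy]; split=> //=; [exact: cimg_mem|rewrite cmapK].
Qed.

Lemma rmul_smooth a c d : atlas c -> atlas d ->
  smooth_on [set y | cimg c y /\ cdom d (cinv c y ** a)] (cmap d \o rmul a \o cinv c).
Proof.
move=> ac ad k; have [b ab ba] := @atlas_cover _ _ G a.
have := Ck_comp_affine _ (fun x => is_diff_pairr x (cmap b a)) _ (mulc_smooth ac ab ad k).
move=> /(_ [set y | cimg c y /\ cdom d (cinv c y ** a)]).
rewrite (_ : (fun x => _) = cmap d \o rmul a \o cinv c); last first.
  by apply/funext => y /=; rewrite /mulc /= cmapK.
apply; first by apply: (open_preimage_cinv (F := rmul a)); [exact: cdom_open|exact: rmul_continuous].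
by move=> y [cy dy]; split=> //=; [exact: cimg_mem|rewrite cmapK].
Qed.

Lemma diffmap_lmul a : diffmap (lg_mul a).
Proof.
split; first exact: lmul_continuous.
move=> c d p [ac cp] [ad dp]; have [df _] := lmul_smooth a ac ad 1.
by apply: df; rewrite /= cmapK //; split=> //; exact: cimg_mem.
Qed.

Lemma diffmap_rmul a : diffmap (rmul a).
Proof.
split; first exact: rmul_continuous.
move=> c d p [ac cp] [ad dp]; have [df _] := rmul_smooth a ac ad 1.
by apply: df; rewrite /= cmapK //; split=> //; exact: cimg_mem.
Qed.

Definition lconj a : G -> G := lg_mul (lg_inv a) \o rmul a.

Lemma diffmap_lconj a : diffmap (lconj a).
Proof. by apply: diffmap_comp; [exact: diffmap_lmul|exact: diffmap_rmul]. Qed.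

(** The coordinate basis of this chart at the identity identifies the Lie algebra with row
    vectors. *)
Definition c0 : chart R n G := sval (cid2 (@atlas_cover _ _ G one)).

Lemma c0P : chart_at c0 one.
Proof. by rewrite /c0; case: cid2. Qed.

(** Row [i] is the value at [p], in the coordinates of [c], of the left-invariant field extending
    the [i]-th coordinate vector of [c0]; [rframe] does the same with right-invariant fields. *)
Definition lframe c p : 'M[R]_n := jac (lg_mul p) c0 c one.
Definition rframe c p : 'M[R]_n := jac (rmul p) c0 c one.
(* The matrix of [Ad (a^-1)] on row vectors, i.e. the components of the right-invariant
   frame in the left-invariant one. *)
Definition AdV a : 'M[R]_n := jac (lconj a) c0 c0 one.

Lemma lconj1 a : lconj a one = one.
Proof. by rewrite /lconj /rmul /= lg_mul1 lg_mulV. Qed.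

Lemma lframe_lmul a c d p : chart_at c p -> chart_at d (a ** p) ->
  lframe d (a ** p) = lframe c p *m jac (lg_mul a) c d p.
Proof.
move=> cp dp; rewrite /lframe.
have -> : lg_mul (a ** p) = lg_mul a \o lg_mul p.
  by apply/funext => q /=; rewrite lg_mulA.
rewrite (jac_comp (d := c) (diffmap_lmul a) (diffmap_lmul p) c0P) /= ?lg_mulg1 //.
Qed.

Lemma lmul1_id : lg_mul one = id :> (G -> G).
Proof. by apply/funext => q; exact: lg_mul1. Qed.

Lemma rmul1_id : rmul one = id :> (G -> G).
Proof. by apply/funext => q; exact: lg_mulg1. Qed.

Lemma lframe_one : lframe c0 one = 1%:M.
Proof. by rewrite /lframe lmul1_id jac_id //; exact: c0P. Qed.

Lemma rframe_one : rframe c0 one = 1%:M.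
Proof. by rewrite /rframe rmul1_id jac_id //; exact: c0P. Qed.

(** Translating back by [lg_inv p] exhibits the identity matrix as a product with this factor. *)
Lemma lframe_unit c p : chart_at c p -> lframe c p \in unitmx.
Proof.
move=> cp; have := @lframe_lmul (lg_inv p) c c0 p cp; rewrite lg_mulV => /(_ c0P) E.
have {}E := etrans (esym lframe_one) E.
by have [] := mulmx1_unit (esym E).
Qed.

(** Right translation by [p] is the conjugation [lconj p] followed by left translation by [p]. *)
Lemma rframeE c p : chart_at c p -> rframe c p = AdV p *m lframe c p.
Proof.
move=> cp; rewrite /rframe /lframe /AdV.
have -> : rmul p = lg_mul p \o lconj p by apply/funext => q; rewrite /= /lconj /= lg_mulKg.
by rewrite (jac_comp (d := c0) (diffmap_lmul p) (diffmap_lconj p) c0P) ?lconj1 ?lg_mulg1 //; exact: c0P.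
Qed.

Lemma AdV1 : AdV one = 1%:M.
Proof. by have := rframeE c0P; rewrite rframe_one lframe_one mulmx1. Qed.

(** Both the conjugation [a^-1 q a] and the row convention reverse the order of products, so the
    order is kept. *)
Lemma AdVM a b : AdV (a ** b) = AdV a *m AdV b.
Proof.
rewrite /AdV; have -> : lconj (a ** b) = lconj b \o lconj a.
  by apply/funext => q; rewrite /lconj /rmul /= lg_invM !lg_mulA.
by rewrite (jac_comp (d := c0) (diffmap_lconj b) (diffmap_lconj a) c0P) ?lconj1 //; exact: c0P.
Qed.

Lemma AdV_unit a : AdV a \in unitmx.
Proof. by have := AdVM a (lg_inv a); rewrite lg_mulgV AdV1 => /esym /mulmx1_unit []. Qed.

Lemma AdVE c p : chart_at c p -> AdV p = rframe c p *m invmx (lframe c p).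
Proof. by move=> cp; rewrite rframeE // mulmxK // lframe_unit. Qed.

End LieGroup.

(** * Smoothness of the invariant frames and their structure constants *)

Section Structure.
Context {R : realType} {n : nat} {G : lieGroup R n}.
Implicit Types (a b p q : G) (c d : chart R n G).
Local Notation "x ** y" := (lg_mul x y) (at level 40, left associativity).
Local Notation one := (lg_one G).
Local Notation c0 := (@c0 R n G).
Local Notation x0 := (cmap c0 one).
Local Notation "\delta_ i" := (delta_mx 0 i : 'rV[R]_n) (at level 8, i at level 2).

Lemma c0_atlas : atlas c0. Proof. exact: (@c0P _ _ G).1. Qed.
Lemma c0_one : cdom c0 one. Proof. exact: (@c0P _ _ G).2. Qed.

Lemma muldom_lframe c x : cimg c x -> muldom c c0 c (x, x0).
Proof.
move=> cx; split=> //=; first by apply: cimg_mem; exact: c0_one.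
by rewrite (cmapK c0_one) lg_mulg1; exact: cinv_dom.
Qed.

Lemma muldom_rframe c x : cimg c x -> muldom c0 c c (x0, x).
Proof.
move=> cx; split=> //=; first by apply: cimg_mem; exact: c0_one.
by rewrite (cmapK c0_one) lg_mul1; exact: cinv_dom.
Qed.

(** Writing the row as a partial derivative of the two-variable multiplication makes its smooth
    dependence on [x] visible and prepares the use of mixed derivatives. *)
Lemma row_lframe c x i : atlas c -> cimg c x ->
  row i (lframe c (cinv c x)) = 'D_(0, \delta_ i) (mulc c c0 c) (x, x0).
Proof.
move=> ac cx; rewrite rowE /lframe.
have cp := chart_at_cinv ac cx.
have dL : differentiable (cmap c \o lg_mul (cinv c x) \o cinv c0) x0.
  by apply: (diffmap_lmul (cinv c x)).2; [exact: c0P|rewrite lg_mulg1].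
apply: etrans (jacE _ dL) _.
rewrite -(derive_comp_diff _ (is_diff_pairl x x0)) //.
have [df _] := mulc_smooth ac c0_atlas ac 1.
by apply: df; exact: muldom_lframe.
Qed.

Lemma row_rframe c x i : atlas c -> cimg c x ->
  row i (rframe c (cinv c x)) = 'D_(\delta_ i, 0) (mulc c0 c c) (x0, x).
Proof.
move=> ac cx; rewrite rowE /rframe.
have cp := chart_at_cinv ac cx.
have dL : differentiable (cmap c \o rmul (cinv c x) \o cinv c0) x0.
  by apply: (diffmap_rmul (cinv c x)).2; [exact: c0P|rewrite /rmul lg_mul1].
apply: etrans (jacE _ dL) _.
rewrite -(derive_comp_diff _ (is_diff_pairr x0 x)) //.
have [df _] := mulc_smooth c0_atlas ac ac 1.
by apply: df; exact: muldom_rframe.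
Qed.

Lemma smooth_rows (U : set 'rV[R]_n) (F : 'rV[R]_n -> 'M[R]_n) : open U ->
  (forall i, smooth_on U (fun x => row i (F x))) -> smooth_on U F.
Proof.
move=> oU H k; apply: Ck_mx => // i j.
have := Ck_coord 0 j oU (H i k).
by under eq_fun do rewrite mxE.
Qed.

Lemma lframe_smooth c : atlas c -> smooth_on (cimg c) (fun x => lframe c (cinv c x)).
Proof.
move=> ac; apply: smooth_rows; first exact: open_cimg.
move=> i k; apply: (@Ck_ext _ _ _ _ _ (fun x => 'D_(0, \delta_ i) (mulc c c0 c) (x, x0))).
- exact: open_cimg.
- by move=> x cx; rewrite row_lframe.
apply: (@Ck_comp_affine _ _ _ _ k _ _ _ _ ('D_(0, \delta_ i) (mulc c c0 c)) (@open_cimg _ _ _ c) (fun x => is_diff_pairr x x0)).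
  exact: muldom_lframe.
by have [_] := mulc_smooth ac c0_atlas ac k.+1; apply.
Qed.

Lemma rframe_smooth c : atlas c -> smooth_on (cimg c) (fun x => rframe c (cinv c x)).
Proof.
move=> ac; apply: smooth_rows; first exact: open_cimg.
move=> i k; apply: (@Ck_ext _ _ _ _ _ (fun x => 'D_(\delta_ i, 0) (mulc c0 c c) (x0, x))).
- exact: open_cimg.
- by move=> x cx; rewrite row_rframe.
apply: (@Ck_comp_affine _ _ _ _ k _ _ _ _ ('D_(\delta_ i, 0) (mulc c0 c c)) (@open_cimg _ _ _ c) (fun x => is_diff_pairl x0 x)).
  exact: muldom_rframe.
by have [_] := mulc_smooth c0_atlas ac ac k.+1; apply.
Qed.

Lemma AdV_smooth c : atlas c -> smooth_on (cimg c) (fun x => AdV (cinv c x)).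
Proof.
move=> ac k.
apply: (@Ck_ext _ _ _ _ _ (fun x => rframe c (cinv c x) *m invmx (lframe c (cinv c x)))).
- exact: open_cimg.
- by move=> x cx; rewrite -AdVE //; exact: chart_at_cinv.
apply: Ck_mulmx; first exact: open_cimg.
  exact: rframe_smooth.
apply: Ck_invmx; first exact: open_cimg.
  by move=> x cx; apply: lframe_unit; exact: chart_at_cinv.
exact: lframe_smooth.
Qed.

Lemma smooth_differentiable (W : normedModType R) c p (F : 'rV[R]_n -> W) : chart_at c p ->
  smooth_on (cimg c) F -> differentiable F (cmap c p).
Proof. by move=> [ac cp] H; have [df _] := H 1; apply: df; exact: cimg_mem. Qed.

(* The matrix of [u |-> [u, e_j]] in the basis of [lframe], acting on rows. *)
Definition adr (j : 'I_n) : 'M[R]_n := 'D_(\delta_ j) (fun x => AdV (cinv c0 x)) x0.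

Lemma near_lmul c p : cdom c p -> \forall y \near x0,
  cimg c0 y /\ cdom c (p ** cinv c0 y).
Proof.
move=> cp; have oO := open_preimage_cinv (c := c0) (cdom_open c) (lmul_continuous (a := p)).
apply: open_nbhs_nbhs; split=> //=; split; first exact: (cimg_mem c0_one).
by rewrite (cmapK c0_one) lg_mulg1.
Qed.

(** Moves left-invariant derivatives to the identity, where the multiplicativity of [AdV] and the
    invariance of the frame can be used. *)
Lemma derive_lmul (W : normedModType R) c p (f : 'rV[R]_n -> W) j : chart_at c p ->
  differentiable f (cmap c p) ->
  'D_(\delta_ j) (fun y => f (cmap c (p ** cinv c0 y))) x0 = 'D_(row j (lframe c p)) f (cmap c p).
Proof.
move=> cp df; have E : (cmap c \o lg_mul p \o cinv c0) x0 = cmap c p.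
  by rewrite /= (cmapK c0_one) lg_mulg1.
have dL : differentiable (cmap c \o lg_mul p \o cinv c0) x0.
  by apply: (diffmap_lmul p).2; [exact: c0P|rewrite lg_mulg1].
have df' : differentiable f ((cmap c \o lg_mul p \o cinv c0) x0) by rewrite E.
apply: etrans (derive_comp_diff _ (differentiableP dL) df') _.
by rewrite E -(deriveE _ dL) -(jacE _ dL) -rowE.
Qed.

(** Differentiate [AdV (p q) = AdV p *m AdV q] in [q] at the identity. *)
Lemma derive_AdV c p j : chart_at c p ->
  'D_(row j (lframe c p)) (fun x => AdV (cinv c x)) (cmap c p) = AdV p *m adr j.
Proof.
move=> cp; rewrite -derive_lmul //; last first.
  by apply: (smooth_differentiable cp); exact: AdV_smooth cp.1.
rewrite /adr -derive_mulmxl; last first.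
  by apply: (smooth_differentiable c0P); exact: AdV_smooth c0_atlas.
apply: near_eq_derive; apply: filterS (near_lmul cp.2) => y [cy dy].
by rewrite cmapK // AdVM.
Qed.

(** Differentiating [rframe = AdV *m lframe] at the identity, where all three are the identity
    matrix, gives [adr j] as the derivative of [rframe] minus that of [lframe]. Row [i] of the first
    is a mixed second derivative of the multiplication, and Schwarz turns it into a derivative of
    row [j] of [lframe]. *)
Lemma row_adr i j : row i (adr j) =
  'D_(\delta_ i) (fun x => row j (lframe c0 (cinv c0 x))) x0
  - 'D_(\delta_ j) (fun x => row i (lframe c0 (cinv c0 x))) x0.
Proof.
have dA : differentiable (fun x => AdV (cinv c0 x)) x0.
  by apply: (smooth_differentiable c0P); exact: AdV_smooth c0_atlas.
have dE : differentiable (fun x => lframe c0 (cinv c0 x)) x0.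
  by apply: (smooth_differentiable c0P); exact: lframe_smooth c0_atlas.
have cx0 : cimg c0 x0 by exact: cimg_mem c0_one.
have adrE : adr j = 'D_(\delta_ j) (fun x => rframe c0 (cinv c0 x)) x0
   - 'D_(\delta_ j) (fun x => lframe c0 (cinv c0 x)) x0.
  apply/eqP; rewrite eq_sym subr_eq; apply/eqP.
  rewrite (@near_eq_derive _ _ _ _ (fun x => AdV (cinv c0 x) *m lframe c0 (cinv c0 x))).
    rewrite derive_mulmx // (cmapK c0_one) (AdV1 (G := G)) lframe_one mulmx1 mul1mx.
    by [].
  by apply: filterS (near_cimg c0_one) => x cx; rewrite rframeE //; apply: (chart_at_cinv _ cx); exact: c0_atlas.
have dX : differentiable (fun x => rframe c0 (cinv c0 x)) x0.
  by apply: (smooth_differentiable c0P); exact: rframe_smooth c0_atlas.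
have mS := mulc_smooth c0_atlas c0_atlas c0_atlas.
have mx0 := muldom_lframe cx0.
have E1 : 'D_(\delta_ j) (fun x => row i (rframe c0 (cinv c0 x))) x0 =
   'D_(0, \delta_ j) ('D_(\delta_ i, 0) (mulc c0 c0 c0)) (x0, x0).
  rewrite (@near_eq_derive _ _ _ _ (fun x => 'D_(\delta_ i, 0) (mulc c0 c0 c0) (x0, x))).
    apply: (derive_comp_diff (f := 'D_(\delta_ i, 0) (mulc c0 c0 c0)) _ (is_diff_pairl x0 x0)).
    by have [_ /(_ (\delta_ i, 0)) [+ _]] := mS 2; apply.
  by apply: filterS (near_cimg c0_one) => x cx; rewrite row_rframe //; exact: c0_atlas.
have E2 : 'D_(\delta_ i) (fun x => row j (lframe c0 (cinv c0 x))) x0 =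
   'D_(\delta_ i, 0) ('D_(0, \delta_ j) (mulc c0 c0 c0)) (x0, x0).
  rewrite (@near_eq_derive _ _ _ _ (fun x => 'D_(0, \delta_ j) (mulc c0 c0 c0) (x, x0))).
    apply: (derive_comp_diff (f := 'D_(0, \delta_ j) (mulc c0 c0 c0)) _ (is_diff_pairr x0 x0)).
    by have [_ /(_ (0, \delta_ j)) [+ _]] := mS 2; apply.
  by apply: filterS (near_cimg c0_one) => x cx; rewrite row_lframe //; exact: c0_atlas.
rewrite E2 -(Ck_schwarz (0, \delta_ j) (\delta_ i, 0) (@open_muldom _ _ _ c0 c0 c0) mx0 (mS 2)) -E1.
by rewrite !derive_row // adrE linearB.
Qed.

(** Left translation by [p], in coordinates [phi], carries the frame near the identity to the frame
    near [p]. Each directional derivative then splits into its value at the identity, pushed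
    forward, and a second derivative of [phi]; the latter is symmetric in [i] and [j] and cancels,
    leaving [row_adr]. *)
Lemma lframe_bracket c p i j : chart_at c p ->
  'D_(row i (lframe c p)) (fun x => row j (lframe c (cinv c x))) (cmap c p)
  - 'D_(row j (lframe c p)) (fun x => row i (lframe c (cinv c x))) (cmap c p)
  = row i (adr j) *m lframe c p.
Proof.
move=> cp; set phi := cmap c \o lg_mul p \o cinv c0.
pose U := [set y | cimg c0 y /\ cdom c (p ** cinv c0 y)].
have oU : open U by exact: (open_preimage_cinv (c := c0) (cdom_open c) (lmul_continuous (a := p))).
have Ux0 : U x0 by split; [exact: cimg_mem c0_one|rewrite (cmapK c0_one) lg_mulg1; exact: cp.2].
have Unear : \forall y \near x0, U y by exact: near_lmul cp.2.
have phiS : Ck 2 U phi by exact: lmul_smooth c0_atlas cp.1 2.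
have [dphi Dphi] := phiS.
have dE : differentiable (fun x => lframe c (cinv c x)) (cmap c p).
  by apply: (smooth_differentiable cp); exact: lframe_smooth cp.1.
have dE0 : differentiable (fun x => lframe c0 (cinv c0 x)) x0.
  by apply: (smooth_differentiable c0P); exact: lframe_smooth c0_atlas.
have drow m k (F : 'rV[R]_n -> 'M[R]_(m, k)) x l : differentiable F x ->
    differentiable (fun y => row l (F y)) x.
  by move=> dF; under eq_fun do rewrite rowE; exact: differentiable_mulmxl.
have dJ : differentiable (fun y => 'J phi y) x0.
  apply/differentiable_mxP => a b.
  apply: (@near_eq_differentiable _ _ _ (fun y => ('D_(\delta_ a) phi y) 0 b)).
    by apply: filterS Unear => y /dphi dphiy; rewrite (deriveEjacobian _ dphiy) -rowE mxE.
  have [+ _] := Dphi (\delta_ a); move=> /(_ x0 Ux0) /differentiable_mxP; exact.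
have J0 : 'J phi x0 = lframe c p.
  by rewrite /lframe jac.unlock.
have key (a b : 'I_n) : 'D_(row a (lframe c p)) (fun x => row b (lframe c (cinv c x))) (cmap c p) =
   'D_(\delta_ a) (fun x => row b (lframe c0 (cinv c0 x))) x0 *m lframe c p
   + 'D_(\delta_ a) ('D_(\delta_ b) phi) x0.
  rewrite -derive_lmul //; last exact: drow.
  rewrite (@near_eq_derive _ _ _ _ (fun y => row b (lframe c0 (cinv c0 y) *m 'J phi y))); last first.
    apply: filterS Unear => y [cy dy]; rewrite cmapK //.
    have cq := chart_at_cinv c0_atlas cy.
    rewrite (lframe_lmul cq) //; last by split=> //; exact: cp.1.
    by rewrite jac.unlock cinvK.
  rewrite (derive_row _ b dE0) derive_row; last exact: differentiable_mulmx.
  rewrite derive_mulmx // (cmapK c0_one) lframe_one mul1mx J0 linearD /= row_mul.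
  congr (_ + _); apply: etrans (esym (derive_row _ b dJ)) _.
  apply: near_eq_derive; apply: filterS Unear => y /dphi dphiy.
  by rewrite (deriveEjacobian _ dphiy) -rowE.
apply: etrans (congr2 (fun A B => A - B) (key i j) (key j i)) _.
have E (A B C D : 'rV[R]_n) : C = D -> A + C - (B + D) = A - B.
  by move=> ->; rewrite opprD addrACA subrr addr0.
by apply: etrans (E _ _ _ _ (Ck_schwarz _ _ oU Ux0 phiS)) _; rewrite -mulmxBl row_adr.
Qed.

End Structure.

(** * Three-dimensional unimodular Lie algebras *)

(** Induction on the size: a vector on which the form does not vanish is made the first basis
    vector, and the Schur complement of the corner entry is diagonalized. *)
Lemma symmetric_congruent_diag (F : numFieldType) n (A : 'M[F]_n) : A^T = A ->
  exists2 P : 'M[F]_n, P \in unitmx & is_diag_mx (P *m A *m P^T).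
Proof.
elim: n A => [|n IH] A sA.
  by exists 1%:M; [exact: unitmx1|apply/is_diag_mxP => -[]].
have [A0|Ane0] := eqVneq A 0.
  by exists 1%:M; [exact: unitmx1|rewrite A0 mulmx0 mul0mx; exact: mx0_is_diag].
have [v vAv] : exists v : 'rV[F]_n.+1, v *m A *m v^T != 0.
  apply: contrapT => H; move/eqP: Ane0; apply.
  have Hv (v : 'rV[F]_n.+1) : v *m A *m v^T = 0.
    by apply/eqP; apply: contrapT => /negP vAv; apply: H; exists v.
  apply/matrixP => i j; rewrite mxE.
  (* Polarization: the form vanishes on [u], [w] and [u + w], so twice the entry [A i j] is zero. *)
  pose u : 'rV[F]_n.+1 := delta_mx 0 i; pose w : 'rV[F]_n.+1 := delta_mx 0 j.
  have := Hv (u + w); rewrite !mulmxDl linearD /= !mulmxDr !Hv add0r addr0.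
  have -> : w *m A *m u^T = u *m A *m w^T.
    have tr11 (B : 'M[F]_1) : B^T = B by rewrite [B]mx11_scalar tr_scalar_mx.
    by rewrite -[LHS]tr11 !trmx_mul trmxK sA mulmxA.
  have -> : u *m A *m w^T = (A i j)%:M.
    rewrite [LHS]mx11_scalar; congr (_%:M).
    by rewrite /u /w trmx_delta -rowE -colE !mxE.
  move=> /matrixP/(_ 0 0); rewrite !mxE /= mulr1n => /eqP.
  by rewrite -mulr2n mulrn_eq0 /= => /eqP.
have [P0 uP0 P00] : exists2 P : 'M[F]_n.+1, P \in unitmx & (P *m A *m P^T) 0 0 != 0.
  (* An invertible matrix whose first row is proportional to [v]. *)
  exists (row_ebase v); first exact: row_ebase_unit.
  have := mulmx_ebase v; set c := col_ebase v; set E := row_ebase v => vE.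
  have v0 : v != 0 by apply: contraNneq vAv => ->; rewrite !mul0mx.
  have rv : \rank v = 1%N by rewrite rank_rV v0.
  apply: contraNneq vAv => E00.
  have vE' : v = c 0 0 *: (delta_mx 0 0 *m E).
    rewrite -vE rv [c]mx11_scalar -mulmxA mul_scalar_mx !mxE mulr1n.
    congr (_ *: (_ *m _)).
    by apply/rowP => k; rewrite !mxE eqxx /= eq_sym; case: k => -[].
  rewrite vE' linearZ /= -!scalemxAl -scalemxAr trmx_mul trmx_delta.
  have -> : (delta_mx 0 0 : 'M[F]_(1, n.+1)) *m E *m A *m (E^T *m (delta_mx 0 0 : 'M[F]_(n.+1, 1))) = ((E *m A *m E^T) 0 0)%:M.
    rewrite [LHS]mx11_scalar; congr (_%:M).
    by rewrite mulmxA -colE [LHS]mxE -!mulmxA -rowE [LHS]mxE.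
  by rewrite E00 raddf0 !scaler0.
have [A' A'def] : {A' : 'M[F]_(1 + n) | P0 *m A *m P0^T = A'} by exists (P0 *m A *m P0^T).
have sA' : A'^T = A' by rewrite -A'def !trmx_mul trmxK sA mulmxA.
have [a aE] : {a | a = A' 0 0} by exists (A' 0 0).
have a0 : a != 0 by rewrite aE -A'def.
pose w := ursubmx A'.
have A'E : A' = block_mx a%:M w w^T (drsubmx A').
  rewrite -[LHS](submxK A'); congr block_mx.
    by rewrite [LHS]mx11_scalar !mxE aE; congr (_%:M); congr (A' _ _); apply: val_inj.
  by rewrite -{1}sA' -trmx_ursub.
pose D := drsubmx A' - a^-1 *: (w^T *m w).
have sD : D^T = D.
  rewrite /D linearB linearZ /= trmx_mul trmxK; congr (_ - _).
  by rewrite trmx_drsub sA'.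
have [P1 uP1 dP1] := IH D sD.
(* Block elimination of the first row and column, which leaves the Schur complement [D]. *)
pose E : 'M[F]_(1 + n) := block_mx 1%:M 0 (- a^-1 *: w^T) 1%:M.
have uE : E \in unitmx by rewrite unitmxE det_lblock !det1 mulr1 unitr1.
pose P2 : 'M[F]_(1 + n) := block_mx 1%:M 0 0 P1.
have uP2 : P2 \in unitmx by rewrite unitmxE det_lblock det1 mul1r -unitmxE.
exists (P2 *m E *m P0); first by rewrite !unitmx_mul uP2 uE.
have -> : P2 *m E *m P0 *m A *m (P2 *m E *m P0)^T = P2 *m (E *m A' *m E^T) *m P2^T.
  by rewrite -A'def !trmx_mul !mulmxA.
have EAE : E *m A' *m E^T = block_mx a%:M 0 0 D.
  rewrite A'E /E tr_block_mx !mulmx_block !trmx1 trmx0 linearZ /= trmxK.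
  rewrite !mul1mx !mul0mx !mulmx1 !mulmx0 !addr0 -!scalemxAl mul_mx_scalar.
  rewrite scalerA mulNr mulVf // scaleN1r addNr mul0mx add0r.
  rewrite -scalemxAr mul_scalar_mx scalerA mulNr mulVf // scaleN1r addNr.
  by rewrite /D scaleNr addrC.
rewrite EAE /P2 tr_block_mx !mulmx_block !trmx1 !trmx0.
rewrite !mul1mx !mul0mx !mulmx1 !mulmx0 !addr0 !add0r !mul0mx.
apply/is_diag_mxP => i j.
have dP1' := is_diag_mxP dP1.
case: (@split_ordP 1 n i) => i' ->; case: (@split_ordP 1 n j) => j' -> ij.
- by move: ij; rewrite !ord1 eqxx.
- by apply: etrans (block_mxEur _ _ _ _ _ _) _; rewrite mxE.
- by apply: etrans (block_mxEdl _ _ _ _ _ _) _; rewrite mxE.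
- apply: etrans (block_mxEdr _ _ _ _ _ _) _; apply: dP1'; move: ij.
  by apply: contraNneq => ij; rewrite /= ij.
Qed.

(** * Indices, determinants and changes of basis in dimension 3 *)

Definition o0 : 'I_3 := @Ordinal 3 0 isT.
Definition o1 : 'I_3 := @Ordinal 3 1 isT.
Definition o2 : 'I_3 := @Ordinal 3 2 isT.

Lemma ord3_ind (P : 'I_3 -> Prop) : P o0 -> P o1 -> P o2 -> forall i, P i.
Proof.
move=> P0 P1 P2 [[|[|[|m]]] lt3] //.
- by rewrite (_ : Ordinal lt3 = o0) //; apply: val_inj.
- by rewrite (_ : Ordinal lt3 = o1) //; apply: val_inj.
- by rewrite (_ : Ordinal lt3 = o2) //; apply: val_inj.
Qed.

Lemma sum3 (V : nmodType) (F : 'I_3 -> V) : \sum_i F i = F o0 + F o1 + F o2.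
Proof.
rewrite !big_ord_recl big_ord0 addr0 addrA.
by congr (F _ + F _ + F _); apply: val_inj.
Qed.

Lemma det_mx33 (R : comNzRingType) (A : 'M[R]_3) : \det A =
  A o0 o0 * (A o1 o1 * A o2 o2 - A o1 o2 * A o2 o1)
  - A o0 o1 * (A o1 o0 * A o2 o2 - A o1 o2 * A o2 o0)
  + A o0 o2 * (A o1 o0 * A o2 o1 - A o1 o1 * A o2 o0).
Proof.
have det2 (B : 'M[R]_2) : \det B = B ord0 ord0 * B ord_max ord_max - B ord0 ord_max * B ord_max ord0.
  rewrite (expand_det_row _ ord0) !big_ord_recl big_ord0 addr0 /cofactor !det_mx11 !mxE.
  rewrite /= expr0 expr1 mul1r mulN1r mulrN.
  by congr (_ * B _ _ - B _ _ * B _ _); apply: val_inj.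
rewrite (expand_det_row _ o0) sum3 /cofactor !det2 !mxE.
have -> : lift o0 (ord0 : 'I_2) = o1 by apply: val_inj.
have -> : lift o0 (ord_max : 'I_2) = o2 by apply: val_inj.
have -> : lift o1 (ord0 : 'I_2) = o0 by apply: val_inj.
have -> : lift o1 (ord_max : 'I_2) = o2 by apply: val_inj.
have -> : lift o2 (ord0 : 'I_2) = o0 by apply: val_inj.
have -> : lift o2 (ord_max : 'I_2) = o1 by apply: val_inj.
rewrite /= addn0 add0n; ring.
Qed.

Lemma mxtrace3 (R : pzRingType) (A : 'M[R]_3) : \tr A = A o0 o0 + A o1 o1 + A o2 o2.
Proof. exact: sum3. Qed.

(** The structure constants in the basis formed by the rows of [Q]: the conjugation changes
    coordinates, and the sum inserts [row j Q] as second argument of the bracket. *)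
Definition change_basis (R : fieldType) n (Q : 'M[R]_n) (K : 'I_n -> 'M[R]_n) (j : 'I_n) : 'M[R]_n :=
  \sum_m Q j m *: (Q *m K m *m invmx Q).

(** * Milnor's normal form for trace-free brackets in dimension 3 *)

Section Milnor.
Variable R : realType.

(** Here [row i (K j)] stands for [[e_i, e_j]]. *)
Definition skew_table (K : 'I_3 -> 'M[R]_3) : Prop :=
  forall i j, row i (K j) = - row j (K i).

Lemma skew_tableE K i j k : skew_table K -> K j i k = - K i j k.
Proof. by move=> /(_ i j) /rowP /(_ k); rewrite !mxE. Qed.

Lemma skew_table0 K i k : skew_table K -> K i i k = 0.
Proof.
by move=> /(@skew_tableE _ i i k) /eqP; rewrite -addr_eq0 -mulr2n mulrn_eq0 => /eqP.
Qed.

Definition bracket (K : 'I_3 -> 'M[R]_3) (u v : 'rV[R]_3) : 'rV[R]_3 :=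
  \sum_m v 0 m *: (u *m K m).

Definition cross (u v : 'rV[R]_3) : 'rV[R]_3 := \row_k
  (if k == o0 then u 0 o1 * v 0 o2 - u 0 o2 * v 0 o1
   else if k == o1 then u 0 o2 * v 0 o0 - u 0 o0 * v 0 o2
   else u 0 o0 * v 0 o1 - u 0 o1 * v 0 o0).

(** The rows are [[e_1, e_2]], [[e_2, e_0]] and [[e_0, e_1]]; this is the matrix [L] of [[u, v] = (u
    x v) L]. *)
Definition structure_mx (K : 'I_3 -> 'M[R]_3) : 'M[R]_3 := \matrix_(i, k)
  (if i == o0 then K o2 o1 k else if i == o1 then K o0 o2 k else K o1 o0 k).

Lemma bracketE K u v : skew_table K -> bracket K u v = cross u v *m structure_mx K.
Proof.
move=> sK; apply/rowP => k; rewrite /bracket summxE sum3 !mxE !sum3 !mxE /=.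
rewrite !(skew_table0 _ _ sK) (skew_tableE o0 o2 _ sK) (skew_tableE o1 o0 _ sK) (skew_tableE o2 o1 _ sK).
ring.
Qed.

(** The differences of opposite entries are, up to sign, the three traces. *)
Lemma structure_mx_sym K : skew_table K -> (forall j, \tr (K j) = 0) ->
  (structure_mx K)^T = structure_mx K.
Proof.
move=> sK tK; apply/matrixP; apply: ord3_ind; apply: ord3_ind; rewrite !mxE //=.
all: have := tK o0; have := tK o1; have := tK o2; rewrite !mxtrace3 !(skew_table0 _ _ sK).
all: rewrite (skew_tableE o0 o2 _ sK) (skew_tableE o1 o0 _ sK) (skew_tableE o2 o1 _ sK); lra.
Qed.

Lemma row_change_basis K (Q : 'M[R]_3) i j :
  row i (change_basis Q K j) = bracket K (row i Q) (row j Q) *m invmx Q.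
Proof.
rewrite /change_basis /bracket linear_sum mulmx_suml; apply: eq_bigr => m _.
by rewrite linearZ /= -scalemxAl !row_mul mxE.
Qed.

Definition milnor_frame (K : 'I_3 -> 'M[R]_3) (Q : 'M[R]_3) (l0 l1 l2 : R) : Prop :=
  [/\ bracket K (row o1 Q) (row o2 Q) = l0 *: row o0 Q,
      bracket K (row o2 Q) (row o0 Q) = l1 *: row o1 Q &
      bracket K (row o0 Q) (row o1 Q) = l2 *: row o2 Q].

Lemma skew_change_basis K (Q : 'M[R]_3) : skew_table K -> skew_table (change_basis Q K).
Proof.
move=> sK i j; rewrite !row_change_basis !bracketE // -mulNmx -mulNmx.
congr (_ *m _ *m _); apply/rowP; apply: ord3_ind; rewrite !mxE /=; ring.
Qed.

(** Let [P L P^T = D] be diagonal and let [Q] be the cofactor matrix of [P], so that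
    [Q P^T = det P]. The cross product of two rows of [Q] is [det P] times the remaining row of [P]
    (in cyclic order), and [row i P *m L] is [D i i / det P] times [row i Q]; the determinants
    cancel in the bracket. *)
Lemma milnor_frame_exists K : skew_table K -> (forall j, \tr (K j) = 0) ->
  exists2 Q : 'M[R]_3, Q \in unitmx & exists l0 l1 l2, milnor_frame K Q l0 l1 l2.
Proof.
move=> sK tK; have [P uP /is_diag_mxP dP] := symmetric_congruent_diag (structure_mx_sym sK tK).
pose Q : 'M[R]_3 := \matrix_i (if i == o0 then cross (row o1 P) (row o2 P)
  else if i == o1 then cross (row o2 P) (row o0 P) else cross (row o0 P) (row o1 P)).
have d0 : \det P != 0 by move: uP; rewrite unitmxE unitfE.
have QP : Q *m P^T = (\det P)%:M.
  apply/matrixP; apply: ord3_ind; apply: ord3_ind; rewrite !mxE sum3 !mxE /= det_mx33; ring.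
have QiP : Q *m ((\det P)^-1 *: P^T) = 1%:M.
  by rewrite -scalemxAr QP scale_scalar_mx mulVf.
have [uQ _] := mulmx1_unit QiP.
have iQ : invmx Q = (\det P)^-1 *: P^T by rewrite -[LHS]mulmx1 -QiP mulKmx.
pose L := structure_mx K; pose D := P *m L *m P^T.
have rowD i : row i P *m L *m P^T = D i i *: delta_mx 0 i.
  rewrite -!row_mul -/D; apply/rowP => j; rewrite [LHS]mxE [RHS]mxE [delta_mx _ _ _ _]mxE eqxx /=.
  have [->|ij] := eqVneq j i; first by rewrite mulr1.
  by rewrite mulr0; apply: dP; rewrite eq_sym.
exists Q => //; exists (D o0 o0), (D o1 o1), (D o2 o2).
have key i u v : cross u v = \det P *: row i P -> cross u v *m L = D i i *: row i Q.
  move=> ->; rewrite -[LHS](mulmxKV uQ) iQ -scalemxAr -!scalemxAl scalerA mulVf ?mulfV // scale1r rowD.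
  by rewrite -scalemxAl -rowE.
split; rewrite bracketE //; apply: key;
  apply/rowP; apply: ord3_ind; rewrite ?mxE /= ?mxE /= ?mxE /= det_mx33; ring.
Qed.

Definition rot3 (i : 'I_3) : 'I_3 := if i == o0 then o1 else if i == o1 then o2 else o0.

Lemma rot3_inj : injective rot3.
Proof. by apply: ord3_ind; apply: ord3_ind. Qed.

Lemma milnor_frame_rot K Q l0 l1 l2 : Q \in unitmx -> milnor_frame K Q l0 l1 l2 ->
  exists2 Q' : 'M[R]_3, Q' \in unitmx & milnor_frame K Q' l1 l2 l0.
Proof.
move=> uQ [b12 b20 b01]; exists (row_perm (perm rot3_inj) Q).
  by rewrite row_permE unitmx_mul unitmx_perm.
have rQ i : row i (row_perm (perm rot3_inj) Q) = row (rot3 i) Q.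
  by apply/rowP => j; rewrite !mxE permE.
by split; rewrite !rQ.
Qed.

(* Left: the right-invariant field through [e_0] is parallel for [diag (t0, t1, t2)].
   Right: the Heisenberg algebra. *)
Definition balanced (l0 l1 l2 : R) : Prop :=
  (exists t0 t1 t2, [/\ 0 < t0, 0 < t1, 0 < t2 & l0 * t0 = l1 * t1 + l2 * t2])
  \/ [/\ l0 != 0, l1 = 0 & l2 = 0].

(** A positive solution of [a t0 = b t1 + c t2] exists as soon as two of [a], [- b], [- c] have
    opposite signs. Two nonzero constants of equal sign are rotated so that one of them comes first,
    two of opposite sign to the last two places. If all vanish any weights do, and a single nonzero
    constant is rotated to the first place. *)
Lemma balanced_rot l0 l1 l2 :
  balanced l0 l1 l2 \/ balanced l1 l2 l0 \/ balanced l2 l0 l1.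
Proof.
(* Two weights are 1; the weight of the coefficient standing alone with its sign is solved for. *)
have S x y z : 0 < x -> y < 0 -> exists t0 t1 t2 : R,
    [/\ 0 < t0, 0 < t1, 0 < t2 & x * t0 + y * t1 + z * t2 = 0].
  move=> x0 y0; have [z0|z0] := leP 0 z.
    exists 1, ((x + z) / - y), 1; split => //; first by rewrite divr_gt0 //; lra.
    by field; rewrite lt_eqF.
  exists ((- y - z) / x), 1, 1; split => //; first by rewrite divr_gt0 //; lra.
  by field; rewrite gt_eqF.
pose B (a b c : R) := exists t0 t1 t2, [/\ 0 < t0, 0 < t1, 0 < t2 & a * t0 = b * t1 + c * t2].
have p1 a b c : 0 < a -> 0 < b -> B a b c.
  move=> a0 b0; have [||t0 [t1 [t2 [? ? ? ?]]]] := S a (- b) (- c); [lra|lra|].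
  by exists t0, t1, t2; split => //; lra.
have p2 a b c : 0 < a -> 0 < c -> B a b c.
  move=> a0 b0; have [||t0 [t2 [t1 [? ? ? ?]]]] := S a (- c) (- b); [lra|lra|].
  by exists t0, t1, t2; split => //; lra.
have p3 a b c : a < 0 -> b < 0 -> B a b c.
  move=> a0 b0; have [||t1 [t0 [t2 [? ? ? ?]]]] := S (- b) a (- c); [lra|lra|].
  by exists t0, t1, t2; split => //; lra.
have p4 a b c : a < 0 -> c < 0 -> B a b c.
  move=> a0 b0; have [||t2 [t0 [t1 [? ? ? ?]]]] := S (- c) a (- b); [lra|lra|].
  by exists t0, t1, t2; split => //; lra.
have p5 a b c : 0 < b -> c < 0 -> B a b c.
  move=> a0 b0; have [||t2 [t1 [t0 [? ? ? ?]]]] := S (- c) (- b) a; [lra|lra|].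
  by exists t0, t1, t2; split => //; lra.
have p6 a b c : b < 0 -> 0 < c -> B a b c.
  move=> a0 b0; have [||t1 [t2 [t0 [? ? ? ?]]]] := S (- b) (- c) a; [lra|lra|].
  by exists t0, t1, t2; split => //; lra.
have p7 : B 0 0 0.
  by exists 1, 1, 1; split => //; rewrite !mul0r addr0.
have [h0|h0|h0] := ltgtP l0 0; have [h1|h1|h1] := ltgtP l1 0; have [h2|h2|h2] := ltgtP l2 0.
all: try rewrite h0; try rewrite h1; try rewrite h2.
all: first [ left; left; first [by apply: p1|by apply: p2|by apply: p3|by apply: p4|by apply: p5|by apply: p6|by apply: p7]
 | right; left; left; first [by apply: p1|by apply: p2|by apply: p3|by apply: p4|by apply: p5|by apply: p6]
 | right; right; left; first [by apply: p1|by apply: p2|by apply: p3|by apply: p4|by apply: p5|by apply: p6]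
 | by left; right; split => //; first [exact: ltr0_neq0|exact: lt0r_neq0]
 | by right; left; right; split => //; first [exact: ltr0_neq0|exact: lt0r_neq0]
 | by right; right; right; split => //; first [exact: ltr0_neq0|exact: lt0r_neq0] ].
Qed.

Lemma balanced_milnor_frame K : skew_table K -> (forall j, \tr (K j) = 0) ->
  exists2 Q : 'M[R]_3, Q \in unitmx &
    exists l0 l1 l2, milnor_frame K Q l0 l1 l2 /\ balanced l0 l1 l2.
Proof.
move=> sK tK; have [Q uQ [l0 [l1 [l2 m0]]]] := milnor_frame_exists sK tK.
have [Q1 uQ1 m1] := milnor_frame_rot uQ m0.
have [Q2 uQ2 m2] := milnor_frame_rot uQ1 m1.
by case: (balanced_rot l0 l1 l2) => [b|[b|b]];
  [exists Q|exists Q1|exists Q2] => //; do 3 eexists; split; eassumption.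
Qed.

Lemma milnor_change_basis K Q l0 l1 l2 : Q \in unitmx -> milnor_frame K Q l0 l1 l2 ->
  [/\ row o1 (change_basis Q K o2) = l0 *: delta_mx 0 o0,
      row o2 (change_basis Q K o0) = l1 *: delta_mx 0 o1 &
      row o0 (change_basis Q K o1) = l2 *: delta_mx 0 o2].
Proof.
move=> uQ [b12 b20 b01]; have rQ i : row i Q *m invmx Q = delta_mx 0 i.
  by rewrite -row_mul mulmxV // rowE mulmx1.
by rewrite !row_change_basis b12 b20 b01 -!scalemxAl !rQ.
Qed.

End Milnor.

(** * Unimodularity makes the adjoint representation trace-free *)

Section Unimodular.
Context {R : realType}.

(** The density at [p] is compared with that at the identity through left and through right
    translation; the two Jacobians are [lframe] and [rframe], which differ by the factor [AdV p]. *)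
Lemma unimodular_AdV n (G : lieGroup R n) (hG : unimodular G) (p : G) :
  `|\det (AdV p)| = 1.
Proof.
have [rho rhoP] := hG.
have [c ac cp] := @atlas_cover _ _ G p; have cP : chart_at c p by [].
have [L _] := rhoP p; have [_ Rr] := rhoP p.
have := L c0 c (lg_one G) (@c0P _ _ G); rewrite lg_mulg1 => /(_ cP).
have -> : 'J (cmap c \o lg_mul p \o cinv c0) (cmap c0 (lg_one G)) = lframe c p.
  by rewrite /lframe jac.unlock.
move=> EL.
have := Rr c0 c (lg_one G) (@c0P _ _ G); rewrite lg_mul1 => /(_ cP).
have -> : 'J (cmap c \o (fun b => lg_mul b p) \o cinv c0) (cmap c0 (lg_one G)) = rframe c p.
  by rewrite /rframe jac.unlock.
rewrite -EL rframeE // det_mulmx normrM => /(mulfI (lt0r_neq0 (dens_pos rho cP))).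
move=> /(congr1 (fun z => z / `|\det (lframe c p)|)); rewrite mulfK ?divff //.
all: by rewrite normr_eq0 -unitfE -unitmxE lframe_unit.
Qed.

(** Jacobi's formula at the identity matrix, from the explicit expansion. *)
Lemma derive_det33 (V : normedModType R) (F : V -> 'M[R]_3) x v :
  differentiable F x -> F x = 1%:M ->
  'D_v (fun y => \det (F y) : R^o) x = \tr ('D_v F x).
Proof.
move=> dF F1; rewrite mxtrace3 !derive_coord //.
pose a i j : V -> R := fun y => F y i j.
have da i j : is_derive x v (a i j) ('D_v (a i j) x).
  by apply: derivableP; apply: diff_derivable; move/differentiable_mxP: dF; apply.
have -> : (fun y => \det (F y) : R^o) =
   a o0 o0 * (a o1 o1 * a o2 o2 - a o1 o2 * a o2 o1)
  - a o0 o1 * (a o1 o0 * a o2 o2 - a o1 o2 * a o2 o0)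
  + a o0 o2 * (a o1 o0 * a o2 o1 - a o1 o1 * a o2 o0) :> (V -> R).
  by apply/funext => y; rewrite det_mx33.
rewrite derive_val !fctE /a F1 !mxE /= /GRing.scale /=; ring.
Qed.

(** Since only the absolute value of [\det (AdV p)] is known, its square, which is constantly 1, is
    differentiated at the identity. *)
Lemma adr_trace (G : lieGroup R 3) (hG : unimodular G) j : \tr (@adr _ _ G j) = 0.
Proof.
pose c := @c0 R 3 G; pose x := cmap c (lg_one G).
have dA : differentiable (fun x => AdV (cinv c x) : 'M[R]_3) x.
  by apply: (smooth_differentiable c0P); exact: AdV_smooth c0_atlas.
have A1 : AdV (cinv c x) = 1%:M :> 'M[R]_3.
  by rewrite /x (cmapK c0_one) AdV1.
rewrite /adr -(derive_det33 _ dA A1).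
set f := fun y => _.
have df : differentiable f x.
  have := Ck_det (@open_cimg _ _ _ c) (@AdV_smooth _ _ G c c0_atlas 1).
  by case=> + _; apply; exact: cimg_mem c0_one.
have f2 : \forall y \near x, 1 = f y * f y.
  by near=> y; rewrite -expr2 -real_normK ?num_real // (unimodular_AdV hG) expr1n.
have : 'D_(delta_mx 0 j) (fun y => f y * f y : R^o) x = 0.
  by rewrite -(near_eq_derive _ f2); exact: derive_cst.
rewrite (@deriveM _ _ f f) ?diff_derivable //; try exact: diff_derivable.
rewrite /f A1 det1 !scale1r => /eqP; rewrite -mulr2n mulrn_eq0 /= => /eqP.
by [].
Unshelve. all: by end_near. Qed.

End Unimodular.

(** * Left-invariant frames in an arbitrary basis of the Lie algebra *)

Section Frame.
Context {R : realType} {n : nat} {G : lieGroup R n}.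
Variable Q : 'M[R]_n.
Hypothesis uQ : Q \in unitmx.
Implicit Types (p q : G) (c d : chart R n G).

Definition frame c p : 'M[R]_n := Q *m lframe c p.
(** Its rows hold the components of the right-invariant fields in the new frame:
    [rframe c p = AdV_frame p *m frame c p]. *)
Definition AdV_frame p : 'M[R]_n := AdV p *m invmx Q.
Definition table : 'I_n -> 'M[R]_n := change_basis Q (@adr R n G).

Lemma frame_unit c p : chart_at c p -> frame c p \in unitmx.
Proof. by move=> cp; rewrite unitmx_mul uQ lframe_unit. Qed.

Lemma AdV_frame_unit p : AdV_frame p \in unitmx.
Proof. by rewrite unitmx_mul unitmx_inv uQ AdV_unit. Qed.

Lemma frame_lmul (a : G) c d p : chart_at c p -> chart_at d (lg_mul a p) ->
  frame d (lg_mul a p) = frame c p *m jac (lg_mul a) c d p.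
Proof. by move=> cp dp; rewrite /frame (lframe_lmul cp dp) mulmxA. Qed.

Lemma frame_change c d p : chart_at c p -> chart_at d p ->
  frame d p = frame c p *m jac id c d p.
Proof.
move=> cp dp; have := @frame_lmul (lg_one G) c d p cp.
by rewrite lg_mul1 lmul1_id; apply.
Qed.

Lemma frame_smooth c : atlas c -> smooth_on (cimg c) (fun x => frame c (cinv c x)).
Proof.
move=> ac k; apply: (@Ck_mulmx _ _ _ _ _ _ _ (fun=> Q)); first exact: open_cimg.
  exact: Ck_cst.
exact: lframe_smooth.
Qed.

Lemma AdV_frame_smooth c : atlas c -> smooth_on (cimg c) (fun x => AdV_frame (cinv c x)).
Proof.
move=> ac k; apply: (@Ck_mulmx _ _ _ _ _ _ _ _ (fun=> invmx Q)); first exact: open_cimg.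
  exact: AdV_smooth.
exact: Ck_cst.
Qed.

Lemma row_frame c p j : row j (frame c p) = \sum_m Q j m *: row m (lframe c p).
Proof.
rewrite /frame row_mul mulmx_sum_row; apply: eq_bigr => m _.
by rewrite mxE.
Qed.

(** The equation [E_j b = [b, e_j]] for right-invariant fields; it follows from [derive_AdV] by
    linearity in the frame. *)
Lemma derive_coframe c p j : chart_at c p ->
  'D_(row j (frame c p)) (fun x => AdV_frame (cinv c x)) (cmap c p) = AdV_frame p *m table j.
Proof.
move=> cp; have dA : differentiable (fun x => AdV (cinv c x)) (cmap c p).
  by apply: (smooth_differentiable cp); exact: AdV_smooth cp.1.
rewrite derive_mulmxr // row_frame derive_dir_sum // /AdV_frame /table /change_basis.
rewrite mulmx_suml mulmx_sumr; apply: eq_bigr => m _.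
by rewrite derive_AdV // -scalemxAl -scalemxAr !mulmxA mulmxKV.
Qed.

Lemma frame_bracket c p i j : chart_at c p ->
  'D_(row i (frame c p)) (fun x => row j (frame c (cinv c x))) (cmap c p)
  - 'D_(row j (frame c p)) (fun x => row i (frame c (cinv c x))) (cmap c p)
  = row i (table j) *m frame c p.
Proof.
move=> cp; have dE : differentiable (fun x => lframe c (cinv c x)) (cmap c p).
  by apply: (smooth_differentiable cp); exact: lframe_smooth cp.1.
have dR a : differentiable (fun x => row a (lframe c (cinv c x))) (cmap c p).
  by under eq_fun do rewrite rowE; exact: differentiable_mulmxl.
have key a b : 'D_(row a (frame c p)) (fun x => row b (frame c (cinv c x))) (cmap c p) =
    \sum_m \sum_k (Q a m * Q b k) *: 'D_(row m (lframe c p)) (fun x => row k (lframe c (cinv c x))) (cmap c p).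
  under eq_fun do rewrite row_mul.
  rewrite row_frame derive_dir_sum; last exact: differentiable_mulmxl.
  apply: eq_bigr => m _; rewrite derive_mulmxl // mulmx_sum_row scaler_sumr.
  by apply: eq_bigr => k _; rewrite derive_row // scalerA !mxE.
rewrite !key [X in _ - X]exchange_big /= -sumrB.
rewrite /table /change_basis linear_sum mulmx_suml.
transitivity (\sum_k \sum_m (Q i m * Q j k) *: (row m (@adr R n G k) *m lframe c p)); last first.
  apply: eq_bigr => k _; rewrite linearZ /= !row_mul -scalemxAl /frame -!mulmxA mulKmx //.
  rewrite mulmxA [row i Q *m _]mulmx_sum_row mulmx_suml scaler_sumr; apply: eq_bigr => m _.
  by rewrite -scalemxAl scalerA mxE [Q j k * _]mulrC.
rewrite exchange_big /=; apply: eq_bigr => m _; rewrite -sumrB; apply: eq_bigr => k _.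
by rewrite [Q j k * _]mulrC -scalerBr lframe_bracket.
Qed.

End Frame.

(** * Killing fields and covariant derivatives in an invariant frame *)

Section FrameMetric.
Context {R : realType} {n : nat} {G : lieGroup R n}.
Variables (Q S : 'M[R]_n).
Hypothesis uQ : Q \in unitmx.
Hypothesis symS : S^T = S.
Hypothesis posS : forall v, v != 0 -> 0 < bilin S v v.
Implicit Types (p q : G) (c d : chart R n G).
Local Notation frame := (@frame R n G Q).
Local Notation table := (@table R n G Q).

(** The metric with constant Gram matrix [S] in the frame, written in coordinates. *)
Definition frame_form c p : 'M[R]_n := invmx (frame c p) *m S *m (invmx (frame c p))^T.

Lemma bilin_frame_form c p u v :
  bilin (frame_form c p) u v = bilin S (u *m invmx (frame c p)) (v *m invmx (frame c p)).
Proof. by rewrite /bilin /frame_form trmx_mul !mulmxA. Qed.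

Lemma frame_form_sym c p : (frame_form c p)^T = frame_form c p.
Proof. by rewrite /frame_form !trmx_mul trmxK symS mulmxA. Qed.

Lemma frame_form_posdef c p : chart_at c p ->
  forall v, v != 0 -> 0 < bilin (frame_form c p) v v.
Proof.
move=> cp v v0; rewrite bilin_frame_form; apply: posS.
apply: contraNneq v0 => vE; rewrite -[v](mulmxKV (frame_unit uQ cp)) vE.
by rewrite mul0mx.
Qed.

Lemma frame_form_lmul (a : G) : preserves_form frame_form (lg_mul a).
Proof.
move=> c d p cp dp u v; rewrite !tmapE !bilin_frame_form.
have uc := frame_unit uQ cp; have ud := frame_unit uQ dp.
suff K (w : 'rV[R]_n) : w *m jac (lg_mul a) c d p *m invmx (frame d (lg_mul a p)) = w *m invmx (frame c p).
  by rewrite !K.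
rewrite -[RHS](mulmxK ud); congr (_ *m _).
by rewrite (frame_lmul _ cp dp) mulmxA mulmxKV.
Qed.

Lemma frame_form_change : preserves_form frame_form id.
Proof. by rewrite -(lmul1_id (G := G)); exact: frame_form_lmul. Qed.

Lemma frame_form_smooth c : atlas c -> smooth_on (cimg c) (frame_form c \o cinv c).
Proof.
move=> ac k; have oc := @open_cimg _ _ _ c.
have Ci : Ck k (cimg c) (fun x => invmx (frame c (cinv c x))).
  apply: Ck_invmx => //; last exact: frame_smooth.
  by move=> x cx; apply: frame_unit => //; exact: chart_at_cinv.
apply: (@Ck_mulmx _ _ _ _ _ _ _ (fun x => invmx (frame c (cinv c x)) *m S)
  (fun x => (invmx (frame c (cinv c x)))^T)) => //.
  by apply: (@Ck_mulmx _ _ _ _ _ _ _ _ (fun=> S)) => //; exact: Ck_cst.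
exact: Ck_trmx.
Qed.

Definition frame_metric : riemannianMetric G :=
  @RiemannianMetric R n G frame_form (fun c p _ => frame_form_sym c p)
    frame_form_posdef frame_form_change frame_form_smooth.

Lemma frame_metric_left_invariant : left_invariant_metric frame_metric.
Proof. exact: frame_form_lmul. Qed.

(** * Vector fields given by their frame components *)

Section Field.
Variable b : G -> 'rV[R]_n.
Hypothesis b_smooth : forall c, atlas c -> smooth_on (cimg c) (b \o cinv c).

Lemma frame_field_change c d p : chart_at c p -> chart_at d p ->
  b p *m frame d p = tmap id c d p (b p *m frame c p).
Proof. by move=> cp dp; rewrite tmapE (frame_change Q cp dp) mulmxA. Qed.

Lemma frame_field_smooth c : atlas c ->
  smooth_on (cimg c) ((fun p => b p *m frame c p) \o cinv c).
Proof.
move=> ac k; apply: (@Ck_mulmx _ _ _ _ _ _ _ (b \o cinv c) (fun x => frame c (cinv c x))).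
- exact: open_cimg.
- exact: b_smooth.
- exact: frame_smooth.
Qed.

Definition frame_field : vectorField G :=
  @VectorField R n G (fun c p => b p *m frame c p) frame_field_change frame_field_smooth.

Lemma table_skew i j c p : chart_at c p -> row i (table j) = - row j (table i).
Proof.
move=> cp; have uE := frame_unit uQ cp.
by rewrite -[LHS](mulmxK uE) -[RHS](mulmxK uE) mulNmx -!frame_bracket // opprB.
Qed.

(* The [i]-th row holds the frame components of [[e_i, X]] for the field [X = frame_field]. *)
Definition lie_mx c p : 'M[R]_n :=
  \matrix_i ('D_(row i (frame c p)) (b \o cinv c) (cmap c p) - b p *m table i).

(** * Lie derivative of the metric and covariant derivative at a point *)

Section AtPoint.
Variables (c : chart R n G) (p : G).
Hypothesis cp : chart_at c p.
Local Notation x := (cmap c p).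
Local Notation E := (frame c p).
Local Notation g := (frame_form c p).
Local Notation Y := (b p *m frame c p).
Local Notation Ef := (fun y => frame c (cinv c y)).
Local Notation gf := (fun y => frame_form c (cinv c y)).
Local Notation bf := (fun y => b (cinv c y)).
Local Notation Yf := (fun y => b (cinv c y) *m frame c (cinv c y)).
Local Notation "\delta_ i" := (delta_mx 0 i : 'rV[R]_n) (at level 8, i at level 2).

Let pK : cinv c x = p. Proof. exact: cmapK cp.2. Qed.
Let dE : differentiable Ef x.
Proof. by apply: (smooth_differentiable cp); exact: frame_smooth cp.1. Qed.
Let dg : differentiable gf x.
Proof. by apply: (smooth_differentiable cp); exact: frame_form_smooth cp.1. Qed.
Let db : differentiable bf x.
Proof. by apply: (smooth_differentiable cp); exact: b_smooth cp.1. Qed.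
Let dY : differentiable Yf x.
Proof. by apply: (smooth_differentiable cp); exact: frame_field_smooth cp.1. Qed.

Let dYm : 'M[R]_n := \matrix_i 'D_(\delta_ i) Yf x.
(** The partial derivatives of the covector [Y^flat], so [Om - Om^T] is [d Y^flat]; below, [L] is
    [L_Y g] in coordinates. *)
Let Om : 'M[R]_n := \matrix_i 'D_(\delta_ i) (fun y => Yf y *m gf y) x.
Let L : 'M[R]_n := 'D_Y gf x + dYm *m g + g *m dYm^T.

Let row_sum_derive m (F : 'rV[R]_n -> 'rV[R]_m) i : differentiable F x ->
  row i (E *m \matrix_k 'D_(\delta_ k) F x) = 'D_(row i E) F x.
Proof.
move=> dF; rewrite row_mul mulmx_sum_row (derive_dir_delta _ dF).
by apply: eq_bigr => k _; rewrite rowK.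
Qed.

Let near_frame_unit : \forall y \near x, Ef y \in unitmx.
Proof.
apply: filterS (near_cimg cp.2) => y cy; apply: frame_unit => //.
by apply: chart_at_cinv => //; exact: cp.1.
Qed.

Let EgE : \forall y \near x, S = Ef y *m gf y *m (Ef y)^T.
Proof.
apply: filterS near_frame_unit => y uE.
by rewrite /frame_form !mulmxA mulmxV // mul1mx -mulmxA -trmx_mul mulmxV // trmx1 mulmx1.
Qed.

Let EgEx : E *m g *m E^T = S.
Proof. by rewrite [RHS](nbhs_singleton EgE) pK. Qed.

Let dET : differentiable (fun y => (Ef y)^T) x.
Proof.
apply/differentiable_mxP => i j; under eq_fun do rewrite mxE.
by move/differentiable_mxP: dE; apply.
Qed.

(** Differentiate the constant matrix [E g E^T = S]. *)
Let derive_metric v : E *m 'D_v gf x *m E^T =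
  - ('D_v Ef x *m g *m E^T + ('D_v Ef x *m g *m E^T)^T).
Proof.
have : 'D_v (fun y => Ef y *m gf y *m (Ef y)^T) x = 0.
  by rewrite -(near_eq_derive _ EgE); exact: derive_cst.
have dEg := differentiable_mulmx dE dg.
rewrite (derive_mulmx _ dEg dET) (derive_mulmx _ dE dg) (derive_trmx _ dE) pK.
rewrite mulmxDl addrAC => /eqP; rewrite addrC addr_eq0 => /eqP ->.
by congr (- (_ + _)); rewrite trmx_mul trmxK trmx_mul frame_form_sym mulmxA.
Qed.

(** The product rule for [Y = b E]: besides the derivative of [b], the derivatives of the frame
    fields combine into brackets. *)
Let lie_mxE i : row i (E *m dYm) - row i ('D_Y Ef x) = row i (lie_mx c p) *m E.
Proof.
rewrite row_sum_derive // (derive_mulmx _ db dE) pK -(derive_row _ i dE).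
have dEi k : differentiable (fun y => row k (Ef y)) x.
  by under eq_fun do rewrite rowE; exact: differentiable_mulmxl.
have -> : 'D_Y (fun y => row i (Ef y)) x = \sum_k b p 0 k *: 'D_(row k E) (fun y => row i (Ef y)) x.
  by rewrite mulmx_sum_row derive_dir_sum.
have -> : b p *m 'D_(row i E) Ef x = \sum_k b p 0 k *: 'D_(row i E) (fun y => row k (Ef y)) x.
  by rewrite mulmx_sum_row; apply: eq_bigr => k _; rewrite derive_row.
rewrite -addrA -sumrB rowK mulmxBl; congr (_ + _).
rewrite [b p *m table i]mulmx_sum_row mulmx_suml -sumrN; apply: eq_bigr => k _.
by rewrite -scalerBr frame_bracket // (table_skew _ _ cp) mulNmx scalerN scalemxAl.
Qed.

(** As [g (e_i, e_j)] is constant, [(L_Y g) (e_i, e_j) = g ([e_i, Y], e_j) + g (e_i, [e_j, Y])]. *)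
Let lie_derivative_frame : E *m L *m E^T = lie_mx c p *m S + (lie_mx c p *m S)^T.
Proof.
have M : E *m dYm - 'D_Y Ef x = lie_mx c p *m E.
  by apply/row_matrixP => i; rewrite linearB /= lie_mxE row_mul.
have -> : lie_mx c p *m S = (E *m dYm - 'D_Y Ef x) *m g *m E^T.
  by rewrite M -EgEx !mulmxA.
rewrite /L !mulmxDr !mulmxDl derive_metric.
have -> : E *m (g *m dYm^T) *m E^T = (E *m (dYm *m g) *m E^T)^T.
  have T (A B C : 'M[R]_n) : A *m (B^T *m C^T) *m A^T = (A *m (C *m B) *m A^T)^T.
    by rewrite !trmx_mul trmxK !mulmxA.
  by rewrite -T frame_form_sym.
have AC (X Z : 'M[R]_n) : - (X + X^T) + Z + Z^T = (Z - X) + (Z - X)^T.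
  by rewrite linearB /= opprD -addrA addrACA [- X + _]addrC [- X^T + _]addrC.
rewrite !mulNmx -AC !mulmxA.
by [].
Qed.

Let frame_conj0 (A : 'M[R]_n) : E *m A *m E^T = 0 -> A = 0.
Proof.
have uE := frame_unit uQ cp; have uET : E^T \in unitmx by rewrite unitmx_tr.
move=> H; have EA0 : E *m A = 0 by rewrite -[LHS](mulmxK uET) H mul0mx.
by rewrite -[A](mulKmx uE) EA0 mulmx0.
Qed.

Lemma lie_derivative0 : lie_mx c p *m S + (lie_mx c p *m S)^T = 0 -> L = 0.
Proof. by rewrite -lie_derivative_frame; exact: frame_conj0. Qed.

Let pd_metric k i j : pd c k (fun q => frame_metric c q i j) p = ('D_(\delta_ k) gf x) i j.
Proof. exact: esym (derive_coord (F := gf) _ i j dg). Qed.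

Let pd_field k i : pd c k (fun q => frame_field c q 0 i) p = dYm k i.
Proof. rewrite /dYm mxE; exact: esym (derive_coord (F := Yf) _ 0 i dY). Qed.

Lemma killing_frame_field_at : lie_mx c p *m S + (lie_mx c p *m S)^T = 0 ->
  forall i j, \sum_k (frame_field c p 0 k * pd c k (fun q => frame_metric c q i j) p
            + frame_metric c p k j * pd c i (fun q => frame_field c q 0 k) p
            + frame_metric c p i k * pd c j (fun q => frame_field c q 0 k) p) = 0.
Proof.
move=> /lie_derivative0 L0 i j; have := congr1 (fun A : 'M[R]_n => A i j) L0.
rewrite /L (derive_dir_delta _ dg) [RHS]mxE => H; rewrite -[RHS]H.
rewrite big_split big_split /= [RHS]mxE [X in _ = X + _]mxE; congr (_ + _ + _).
- by rewrite summxE; apply: eq_bigr => k _; rewrite pd_metric [RHS]mxE.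
- by rewrite [RHS]mxE; apply: eq_bigr => k _; rewrite pd_field mulrC.
- by rewrite [RHS]mxE; apply: eq_bigr => k _; rewrite pd_field [dYm^T _ _]mxE.
Qed.

Let om0 : Y *m g *m E^T = b p *m S.
Proof. by rewrite -EgEx !mulmxA. Qed.

Let dom : differentiable (fun y => Yf y *m gf y) x.
Proof. exact: differentiable_mulmx. Qed.

(** The product rule for the pairing [Y^flat (e_j) = (b S)_j], differentiated along [e_i]. *)
Let covector_frame i j : (E *m Om *m E^T) i j =
  ('D_(row i E) bf x *m S) 0 j - (Y *m g *m (row j ('D_(row i E) Ef x))^T) 0 0.
Proof.
have nE : \forall y \near x, bf y *m S = (Yf y *m gf y) *m (Ef y)^T.
  by apply: filterS EgE => y ->; rewrite !mulmxA.
have := @near_eq_derive _ _ _ _ _ _ (row i E) nE.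
rewrite (derive_mulmxr _ _ db) (derive_mulmx _ dom dET) (derive_trmx _ dE) pK => ->.
have -> : (E *m Om *m E^T) i j = (row i (E *m Om) *m E^T) 0 j by rewrite -row_mul [RHS]mxE.
rewrite row_sum_derive // [X in _ = X - _]mxE.
have -> : (Y *m g *m ('D_(row i E) Ef x)^T) 0 j = (Y *m g *m (row j ('D_(row i E) Ef x))^T) 0 0.
  by rewrite [LHS]mxE [RHS]mxE; apply: eq_bigr => l _; congr (_ * _); rewrite [LHS]mxE [RHS]mxE [RHS]mxE.
by rewrite addrK.
Qed.

(** Cartan's formula [d Y^flat (e_i, e_j) = e_i (Y^flat e_j) - e_j (Y^flat e_i) - Y^flat
    [e_i, e_j]]; the hypothesis says that the right side is zero. *)
Let Om_antisym : (forall i j, ('D_(row i E) bf x *m S) 0 j - ('D_(row j E) bf x *m S) 0 i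
     = (b p *m S *m (row i (table j))^T) 0 0) -> Om - Om^T = 0.
Proof.
move=> hO; apply: frame_conj0; apply/matrixP => i j; rewrite [RHS]mxE.
have -> : (E *m (Om - Om^T) *m E^T) i j = (E *m Om *m E^T) i j - (E *m Om *m E^T) j i.
  have T (A B : 'M[R]_n) : A *m B^T *m A^T = (A *m B *m A^T)^T.
    by rewrite !trmx_mul trmxK !mulmxA.
  by rewrite mulmxBr mulmxBl T [LHS]mxE [X in _ + X = _]mxE [X in _ - X = _]mxE.
rewrite !covector_frame.
set A := 'D_(row i E) bf x *m S; set B := 'D_(row j E) bf x *m S.
have Hs : (Y *m g *m (row j ('D_(row i E) Ef x))^T) 0 0 - (Y *m g *m (row i ('D_(row j E) Ef x))^T) 0 0
    = (b p *m S *m (row i (table j))^T) 0 0.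
  have -> : b p *m S *m (row i (table j))^T = Y *m g *m (row i (table j) *m E)^T.
    by rewrite [(_ *m E)^T]trmx_mul mulmxA om0.
  have -> : row i (table j) *m E = row j ('D_(row i E) Ef x) - row i ('D_(row j E) Ef x).
    by apply: etrans (esym (frame_bracket uQ i j cp)) _; congr (_ - _); exact: derive_row dE.
  have T (u v w : 'rV[R]_n) : (u *m (v - w)^T) 0 0 = (u *m v^T) 0 0 - (u *m w^T) 0 0.
    by rewrite linearB mulmxBr [LHS]mxE [X in _ + X = _]mxE.
  by rewrite T.
by move: Hs; rewrite -hO -/A -/B; lra.
Qed.

(** Twice the Christoffel symbols with lowered upper index, contracted with [Y]. *)
Let W : 'M[R]_n := \matrix_(i, l) \sum_j Y 0 j *
  (('D_(\delta_ i) gf x) j l + ('D_(\delta_ j) gf x) i l - ('D_(\delta_ l) gf x) i j).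

Let metric_derivative_sym k i j : ('D_(\delta_ k) gf x) i j = ('D_(\delta_ k) gf x) j i.
Proof.
have H : 'D_(\delta_ k) gf x = ('D_(\delta_ k) gf x)^T.
  have Eg : (fun y => (gf y)^T) = gf by apply/funext => y; rewrite frame_form_sym.
  by have := derive_trmx (\delta_ k) dg; rewrite Eg.
by rewrite [in LHS]H mxE.
Qed.

(* Twice the covariant derivative of [Y^flat] is the sum of its symmetric part [L_Y g]
   and its skew part [d Y^flat]. *)
Let christoffel_split : 2 *: (dYm *m g) + W = L + (Om - Om^T).
Proof.
apply/matrixP => i l.
have OmE a e : Om a e = (dYm *m g) a e + \sum_j Y 0 j * ('D_(\delta_ a) gf x) j e.
  rewrite mxE (derive_mulmx _ dY dg) pK [LHS]mxE; congr (_ + _); last by rewrite mxE.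
  by rewrite [LHS]mxE [RHS]mxE; apply: eq_bigr => k _; rewrite [dYm _ _]mxE.
have gdY : (g *m dYm^T) i l = (dYm *m g) l i.
  have T (A B : 'M[R]_n) : A^T = A -> (A *m B^T) i l = (B *m A) l i.
    by move=> sA; rewrite -[in LHS]sA -trmx_mul mxE.
  exact: T (frame_form_sym c p).
have LE : L i l = \sum_j Y 0 j * ('D_(\delta_ j) gf x) i l + (dYm *m g) i l + (dYm *m g) l i.
  rewrite /L (derive_dir_delta _ dg) [LHS]mxE gdY [X in X + _]mxE; congr (_ + _ + _).
  by rewrite summxE; apply: eq_bigr => k _; rewrite mxE.
have WE : W i l = \sum_j Y 0 j * ('D_(\delta_ i) gf x) j l
    + \sum_j Y 0 j * ('D_(\delta_ j) gf x) i l - \sum_j Y 0 j * ('D_(\delta_ l) gf x) j i.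
  rewrite mxE -big_split -sumrB; apply: eq_bigr => j _ /=.
  by rewrite mulrBr mulrDr; congr (_ - _ * _); exact: metric_derivative_sym.
have OmT : (Om - Om^T) i l = Om i l - Om l i by rewrite [LHS]mxE; congr (_ + _); rewrite 2!mxE.
rewrite [LHS]mxE WE [RHS]mxE LE OmT OmE OmE mxE.
set a1 := \sum_j _; set a2 := \sum_j _; set a3 := \sum_j _.
by move: a1 a2 a3 ((dYm *m g) i l) ((dYm *m g) l i) => a1 a2 a3 u v; ring.
Qed.

Let S_unit : S \in unitmx.
Proof.
rewrite -row_free_unit -kermx_eq0; apply: contraT => /rowV0Pn [v vk v0].
have := posS v0; rewrite /bilin; move/sub_kermxP: vk => ->.
by rewrite mul0mx mxE ltxx.
Qed.

Let metric_unit : g \in unitmx.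
Proof.
have uE : invmx E \in unitmx by rewrite unitmx_inv frame_unit.
by rewrite /frame_form !unitmx_mul unitmx_tr uE S_unit.
Qed.

Let nabla_mx i k : nabla frame_metric frame_field c p i k =
  (dYm + 2^-1 *: (W *m invmx g)) i k.
Proof.
rewrite /nabla pd_field [RHS]mxE; congr (_ + _); rewrite [RHS]mxE [(W *m _) _ _]mxE.
have gVsym : (invmx g)^T = invmx g by rewrite trmx_inv frame_form_sym.
rewrite mulr_sumr; under [RHS]eq_bigr => l _ do rewrite [W _ _]mxE mulr_suml mulr_sumr.
rewrite [RHS]exchange_big /=; apply: eq_bigr => j _.
rewrite /christoffel mulr_sumr mulr_suml; apply: eq_bigr => l _.
rewrite !pd_metric -[in RHS]gVsym [(invmx g)^T _ _]mxE; ring.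
Qed.

(** The hypotheses make the symmetric part [L_Y g] and the skew part [d Y^flat] of the covariant
    derivative vanish. *)
Lemma nabla_frame_field_at : lie_mx c p *m S + (lie_mx c p *m S)^T = 0 ->
  (forall i j, ('D_(row i E) bf x *m S) 0 j - ('D_(row j E) bf x *m S) 0 i
     = (b p *m S *m (row i (table j))^T) 0 0) ->
  forall i k, nabla frame_metric frame_field c p i k = 0.
Proof.
move=> hL hO i k.
have W0 : W = - (2 *: (dYm *m g)).
  apply/eqP; rewrite -addr_eq0 addrC christoffel_split lie_derivative0 //.
  by rewrite Om_antisym // addr0.
rewrite nabla_mx W0 mulNmx -scalemxAl mulmxK; last exact: metric_unit.
by rewrite scalerN scalerA mulVf // scale1r subrr mxE.
Qed.

End AtPoint.
End Field.
End FrameMetric.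

Lemma symmetry_index_gt0 (R : realType) n (M : manifold R n) (g : riemannianMetric M)
    (X : vectorField M) (c : chart R n M) (p : M) : (0 < n)%N ->
  chart_at c p -> killing g X -> X c p != 0 -> (forall i k, nabla g X c p i k = 0) ->
  (1 <= symmetry_index g p)%N.
Proof.
move=> n0 cp kX X0 nX; pose k1 : 'I_n.+1 := @Ordinal n.+1 1 n0.
rewrite /symmetry_index; apply: (@leq_bigmax_cond _ _ (fun k : 'I_n.+1 => nat_of_ord k) k1).
apply/asboolP; exists c; split=> //; exists (X c p : 'M[R]_(k1, n)).
  by rewrite /row_free rank_rV X0.
move=> i; exists X; split=> //.
by apply/rowP => j; rewrite mxE !ord1.
Qed.

(** * Parallel Killing fields at a point in dimension 3 *)

Section Dimension3.
Context {R : realType} {G : lieGroup R 3}.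
Variable Q : 'M[R]_3.
Hypothesis uQ : Q \in unitmx.
Local Notation tau := (@table R 3 G Q).
Local Notation e0 := (delta_mx 0 o0 : 'rV[R]_3).
Hypothesis tau_skew : skew_table tau.

Definition gram (t : 'I_3 -> R) : 'M[R]_3 := diag_mx (\row_i t i).

Lemma gram_sym t : (gram t)^T = gram t.
Proof. exact: tr_diag_mx. Qed.

Lemma mul_gram t (v : 'rV[R]_3) j : (v *m gram t) 0 j = v 0 j * t j.
Proof. by rewrite mul_mx_diag !mxE. Qed.

Lemma gram_posdef t : (forall i, 0 < t i) -> forall v, v != 0 -> 0 < bilin (gram t) v v.
Proof.
move=> t0 v /rV0Pn[i vi]; rewrite /bilin mxE (bigD1 i) //= mul_gram mxE.
rewrite ltr_pwDl //; first by rewrite mulrAC -expr2 mulr_gt0 // exprn_even_gt0.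
by apply: sumr_ge0 => j _; rewrite mul_gram mxE mulrAC -expr2 mulr_ge0 ?sqr_ge0 // ltW.
Qed.

(** The last two conditions are [L_Y g = 0] everywhere and [d Y^flat = 0] at [p]. At [p] the
    covector is [t o0] times the dual of [e_0], so Cartan's formula involves only the [e_0]
    component [tau j i o0] of [[e_i, e_j]]. *)
Lemma parallel_field (t : 'I_3 -> R) (t0 : forall i, 0 < t i) (b : G -> 'rV[R]_3) (p : G) :
  (forall c, atlas c -> smooth_on (cimg c) (b \o cinv c)) -> b p = e0 ->
  (forall c q, chart_at c q -> lie_mx Q b c q *m gram t + (lie_mx Q b c q *m gram t)^T = 0) ->
  (forall c, chart_at c p -> forall i j,
    'D_(row i (frame Q c p)) (b \o cinv c) (cmap c p) 0 j * t j
    - 'D_(row j (frame Q c p)) (b \o cinv c) (cmap c p) 0 i * t i = t o0 * tau j i o0) ->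
  (1 <= symmetry_index (frame_metric uQ (gram_sym t) (gram_posdef t0)) p)%N.
Proof.
move=> bs bp kb nb; have [c ac cp] := @atlas_cover _ _ G p.
have cP : chart_at c p by [].
apply: (@symmetry_index_gt0 _ _ _ _ (frame_field Q bs) c) => //.
- move=> d q dq; apply: killing_frame_field_at => //; exact: kb.
- rewrite /= bp; apply/negP => /eqP H; have := mulmxK (frame_unit uQ cP) e0.
  rewrite H mul0mx => /rowP /(_ o0); rewrite !mxE eqxx /= => /eqP.
  by rewrite eq_sym oner_eq0.
- apply: nabla_frame_field_at => // [|i j]; first exact: kb.
  rewrite bp; apply: etrans (congr2 (fun u v => u - v) (mul_gram t _ j) (mul_gram t _ i)) _.
  apply: etrans (nb c cP i j) _; rewrite mxE (bigD1 o0) //= mul_gram big1 ?addr0 => [|k k0].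
    by rewrite !mxE eqxx mul1r.
  by rewrite mul_gram !mxE (negbTE k0) !mul0r.
Qed.

Section Cases.
Variables l0 l1 l2 : R.
Hypothesis tau12 : row o1 (tau o2) = l0 *: delta_mx 0 o0.
Hypothesis tau20 : row o2 (tau o0) = l1 *: delta_mx 0 o1.
Hypothesis tau01 : row o0 (tau o1) = l2 *: delta_mx 0 o2.

Let tau12E k : tau o2 o1 k = l0 * (k == o0)%:R.
Proof. by have /rowP/(_ k) := tau12; rewrite !mxE eqxx. Qed.
Let tau20E k : tau o0 o2 k = l1 * (k == o1)%:R.
Proof. by have /rowP/(_ k) := tau20; rewrite !mxE eqxx. Qed.
Let tau01E k : tau o1 o0 k = l2 * (k == o2)%:R.
Proof. by have /rowP/(_ k) := tau01; rewrite !mxE eqxx. Qed.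

Let tauE := (fun i k => skew_table0 i k tau_skew, fun k => skew_tableE o0 o2 k tau_skew,
  fun k => skew_tableE o1 o0 k tau_skew, fun k => skew_tableE o2 o1 k tau_skew,
  tau12E, tau20E, tau01E).

Lemma right_invariant_case (t : 'I_3 -> R) (t0 : forall i, 0 < t i) (p : G) :
  l0 * t o0 = l1 * t o1 + l2 * t o2 ->
  (1 <= symmetry_index (frame_metric uQ (gram_sym t) (gram_posdef t0)) p)%N.
Proof.
(* The combination of right-invariant fields whose value at [p] is [e_0]. *)
move=> lt; pose w := e0 *m invmx (AdV_frame Q p).
pose b (q : G) := w *m AdV_frame Q q.
have db c q i : chart_at c q ->
    'D_(row i (frame Q c q)) (b \o cinv c) (cmap c q) = b q *m tau i.
  move=> cq; have dB : differentiable (fun y => AdV_frame Q (cinv c y)) (cmap c q).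
    by apply: (smooth_differentiable cq); exact: AdV_frame_smooth cq.1.
  by apply: etrans (derive_mulmxl w _ dB) _; rewrite derive_coframe // mulmxA.
have bp : b p = e0 by rewrite /b /w mulmxKV // AdV_frame_unit.
apply: (@parallel_field t t0 b) => //.
- move=> c ac k; apply: (@Ck_mulmx _ _ _ _ _ _ _ (fun=> w)); first exact: open_cimg.
    exact: Ck_cst.
  exact: AdV_frame_smooth.
- move=> c q cq; rewrite (_ : lie_mx Q b c q = 0) ?mul0mx ?trmx0 ?addr0 //.
  by apply/row_matrixP => i; rewrite rowK db // subrr row0.
move=> c cp i j; rewrite !db // bp -!rowE.
(* Up to order only the pair [(1, 2)] gives a condition, namely [l1 t1 + l2 t2 = l0 t0]. *)
move: i j; apply: ord3_ind; apply: ord3_ind; rewrite ![row _ _ _ _]mxE !tauE /=; lra.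
Qed.

(** * The Heisenberg case *)

Definition ones (_ : 'I_3) : R := 1.

Let C (q : G) : 'M[R]_3 := invmx (AdV_frame Q q).
(* The row [e_0] of [C = Ad] is locally constant but not globally so; [H] serves to
   normalize by its square norm [H q o0 o0]. *)
Let H (q : G) : 'M[R]_3 := C q *m (C q)^T.

Let C_smooth c k : atlas c -> Ck k (cimg c) (fun y => C (cinv c y)).
Proof.
move=> ac; apply: Ck_invmx; first exact: open_cimg.
  by move=> y _; exact: AdV_frame_unit.
exact: AdV_frame_smooth.
Qed.

Let H_smooth c k : atlas c -> Ck k (cimg c) (fun y => H (cinv c y)).
Proof.
move=> ac; have oc := @open_cimg _ _ _ c.
apply: (@Ck_mulmx _ _ _ _ _ _ _ (fun y => C (cinv c y)) (fun y => (C (cinv c y))^T)) => //.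
  exact: C_smooth.
by apply: Ck_trmx => //; exact: C_smooth.
Qed.

(** Differentiate [AdV_frame *m C = 1]. *)
Let derive_C c q i : chart_at c q ->
  'D_(row i (frame Q c q)) (fun y => C (cinv c y)) (cmap c q) = - (tau i *m C q).
Proof.
move=> cq; have dB : differentiable (fun y => AdV_frame Q (cinv c y)) (cmap c q).
  by apply: (smooth_differentiable cq); exact: AdV_frame_smooth cq.1.
have dC : differentiable (fun y => C (cinv c y)) (cmap c q).
  by apply: (smooth_differentiable cq) => k; exact: C_smooth cq.1.
have E1 : (fun y => AdV_frame Q (cinv c y) *m C (cinv c y)) = cst 1%:M.
  by apply/funext => y; rewrite mulmxV // AdV_frame_unit.
have := derive_mulmx (row i (frame Q c q)) dB dC.
rewrite E1 derive_cst (cmapK cq.2) derive_coframe // => /esym/eqP.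
rewrite -mulmxA -mulmxDr => /eqP E2.
have := mulKmx (AdV_frame_unit uQ q) (tau i *m C q +
  'D_(row i (frame Q c q)) (fun y => C (cinv c y)) (cmap c q)).
by rewrite E2 mulmx0 => /esym/eqP; rewrite addrC addr_eq0 => /eqP.
Qed.

Let derive_H c q i : chart_at c q ->
  'D_(row i (frame Q c q)) (fun y => H (cinv c y)) (cmap c q) = - (tau i *m H q + (tau i *m H q)^T).
Proof.
move=> cq; have dC : differentiable (fun y => C (cinv c y)) (cmap c q).
  by apply: (smooth_differentiable cq) => k; exact: C_smooth cq.1.
have dCT : differentiable (fun y => (C (cinv c y))^T) (cmap c q).
  by apply: (smooth_differentiable cq) => k; apply: Ck_trmx;
    [exact: open_cimg|exact: C_smooth cq.1].
apply: etrans (derive_mulmx _ dC dCT) _.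
rewrite (derive_trmx _ dC) derive_C // (cmapK cq.2) linearN /= mulNmx mulmxN -opprD.
by rewrite !trmx_mul trmxK !mulmxA.
Qed.

Let H00 q : H q o0 o0 != 0.
Proof.
have r0 : row o0 (C q) != 0.
  apply/negP => /eqP r0; have uC : C q \in unitmx by rewrite unitmx_inv AdV_frame_unit.
  have := mulmxK uC e0; rewrite -rowE r0 mul0mx => /rowP /(_ o0); rewrite !mxE eqxx /= => /eqP.
  by rewrite eq_sym oner_eq0.
have -> : H q o0 o0 = \sum_k row o0 (C q) 0 k * row o0 (C q) 0 k.
  by rewrite mxE; apply: eq_bigr => k _; rewrite !mxE.
have /rV0Pn[k vk] := r0.
rewrite gt_eqF // (bigD1 k) //= ltr_pwDl // -?expr2 ?exprn_even_gt0 //.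
by apply: sumr_ge0 => j _; rewrite -expr2 sqr_ge0.
Qed.

(** With [Y], the coefficient of the orthogonal projection of row [e_2] (for [Y], row [e_1]) of
    [C q] onto its row [e_0]. In the Heisenberg case these rows vary only along row [e_0]. *)
Let X (q : G) : R := H q o2 o0 / H q o0 o0.
Let Y (q : G) : R := H q o1 o0 / H q o0 o0.

Let quot_smooth c k a : atlas c ->
  Ck k (cimg c) (fun y => H (cinv c y) a o0 / H (cinv c y) o0 o0 : R^o).
Proof.
move=> ac; have oc := @open_cimg _ _ _ c; apply: Ck_mul => //.
  by apply: (Ck_coord _ _ oc); exact: H_smooth.
apply: Ck_inv => //; apply: (Ck_coord _ _ oc); exact: H_smooth.
Qed.

Hypotheses (l10 : l1 = 0) (l20 : l2 = 0).

Let tau0 i k : tau i o0 k = 0.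
Proof. by move: i; apply: ord3_ind; rewrite !tauE ?l10 ?l20 ?mul0r ?oppr0. Qed.

Let tau_col i a k : k != o0 -> tau i a k = 0.
Proof.
move: i a k; apply: ord3_ind; apply: ord3_ind; apply: ord3_ind => // _;
  by rewrite !tauE ?l10 ?l20 ?mul0r ?mulr0 ?oppr0.
Qed.

(** As [e_0] is central, the denominator has zero derivative; as every bracket is a multiple of
    [e_0], the derivative of the numerator is a multiple of that denominator, which cancels. *)
Let derive_quot c q i a : chart_at c q ->
  is_derive (cmap c q) (row i (frame Q c q))
    (fun y => H (cinv c y) a o0 / H (cinv c y) o0 o0 : R) (- (tau i a o0)).
Proof.
move=> cq; have dq := @quot_smooth c 1 a cq.1.
have dH : differentiable (fun y => H (cinv c y)) (cmap c q).
  by apply: (smooth_differentiable cq) => k; exact: H_smooth cq.1.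
have dHe e : is_derive (cmap c q) (row i (frame Q c q)) (fun y => H (cinv c y) e o0 : R)
    (- (tau i e o0 * H q o0 o0)).
  have dHe' : differentiable (fun y => H (cinv c y) e o0 : R^o) (cmap c q).
    by move/differentiable_mxP: dH; apply.
  split; first exact: diff_derivable.
  apply: etrans (esym (derive_coord _ _ _ dH)) _; rewrite derive_H //.
  have E1 : (tau i *m H q) e o0 = tau i e o0 * H q o0 o0.
    by rewrite mxE sum3 (tau_col i e (k := o1)) // (tau_col i e (k := o2)) // !mul0r !addr0.
  have E2 : (tau i *m H q)^T e o0 = 0.
    by rewrite 2!mxE big1 // => k _; rewrite tau0 mul0r.
  by rewrite mxE [X in - X]mxE E1 E2 addr0.
have d1 := dHe a; have d0 := dHe o0.
have H0x : H (cinv c (cmap c q)) o0 o0 != 0 by exact: H00.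
have dV : is_derive (cmap c q) (row i (frame Q c q)) (fun y => (H (cinv c y) o0 o0)^-1 : R) 0.
  have [d0d d0v] := d0; split; first exact: derivableV.
  by rewrite deriveV // d0v tau0 mul0r oppr0 scaler0.
have := is_deriveM d1 dV; rewrite scaler0 add0r.
by rewrite (cmapK cq.2) /GRing.scale /= mulrN mulrCA mulVf ?H00 // mulr1.
Qed.

(* In the Heisenberg case the only nonzero frame derivatives of [X] and [Y] are
   [E_1 X = l0] and [E_2 Y = - l0]. The field is [e_0] plus the rotation fixing [p],
   with speed [l0 / 2], the one for which the covariant derivative at [p] vanishes. *)
Definition heis_coef (p q : G) : 'rV[R]_3 := \row_k
  (if k == o0 then 1 - ((X q - X p) ^+ 2 + (Y q - Y p) ^+ 2) / 4
   else if k == o1 then (Y q - Y p) / 2 else (X q - X p) / 2).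

Let heis_coef_smooth p c : atlas c -> smooth_on (cimg c) (heis_coef p \o cinv c).
Proof.
move=> ac k; have oc := @open_cimg _ _ _ c; apply: Ck_mx => // i j.
rewrite /heis_coef /=; under eq_fun do rewrite mxE.
have Cx : Ck k (cimg c) (fun y => X (cinv c y) + - X p : R^o).
  by apply: Ck_add => //; [exact: quot_smooth|exact: Ck_cst].
have Cy : Ck k (cimg c) (fun y => Y (cinv c y) + - Y p : R^o).
  by apply: Ck_add => //; [exact: quot_smooth|exact: Ck_cst].
case: (j == o0); last by case: (j == o1); apply: Ck_mul => //; exact: Ck_cst.
have Cs : Ck k (cimg c) (fun y => ((X (cinv c y) - X p) * (X (cinv c y) - X p)
    + (Y (cinv c y) - Y p) * (Y (cinv c y) - Y p)) * - 4^-1 : R^o).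
  apply: Ck_mul => //; last exact: Ck_cst.
  by apply: Ck_add => //; exact: Ck_mul.
have := Ck_add oc (Ck_cst k (cimg c) (1 : R^o)) Cs.
by under eq_fun do rewrite mulrN.
Qed.

Let derive_heis_coef p c q i : chart_at c q ->
  'D_(row i (frame Q c q)) (heis_coef p \o cinv c) (cmap c q) = \row_k
  (if k == o0 then ((X q - X p) * tau i o2 o0 + (Y q - Y p) * tau i o1 o0) / 2
   else if k == o1 then - tau i o1 o0 / 2 else - tau i o2 o0 / 2).
Proof.
move=> cq; have db := smooth_differentiable cq (@heis_coef_smooth p c cq.1).
have dX : is_derive (cmap c q) (row i (frame Q c q)) (fun y => X (cinv c y) : R) (- tau i o2 o0).
  exact: derive_quot.
have dY : is_derive (cmap c q) (row i (frame Q c q)) (fun y => Y (cinv c y) : R) (- tau i o1 o0).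
  exact: derive_quot.
have dXs := is_deriveB dX (is_derive_cst (X p) (cmap c q) (row i (frame Q c q))).
have dYs := is_deriveB dY (is_derive_cst (Y p) (cmap c q) (row i (frame Q c q))).
apply/rowP => k; rewrite [RHS]mxE; apply: etrans (derive_coord _ _ _ db) _.
rewrite /heis_coef /=; under eq_fun do rewrite mxE.
case: (k == o0).
  have := is_deriveB (is_derive_cst (1 : R) (cmap c q) (row i (frame Q c q)))
    (is_deriveM (is_deriveD (is_deriveM dXs dXs) (is_deriveM dYs dYs))
       (is_derive_cst (4^-1 : R) (cmap c q) (row i (frame Q c q)))).
  case=> _ /= dv; apply: etrans dv _.
  by rewrite !fctE /= (cmapK cq.2) /GRing.scale /=; lra.
case: (k == o1).
  have := is_deriveM dYs (is_derive_cst (2^-1 : R) (cmap c q) (row i (frame Q c q))).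
  case=> _ /= dv; apply: etrans dv _.
  by rewrite !fctE /= /GRing.scale /=; lra.
have := is_deriveM dXs (is_derive_cst (2^-1 : R) (cmap c q) (row i (frame Q c q))).
case=> _ /= dv; apply: etrans dv _.
by rewrite !fctE /= /GRing.scale /=; lra.
Qed.

Lemma heisenberg_case (t0 : forall i, 0 < ones i) (p : G) :
  (1 <= symmetry_index (frame_metric uQ (gram_sym ones) (gram_posdef t0)) p)%N.
Proof.
apply: (@parallel_field ones t0 (heis_coef p)).
- exact: heis_coef_smooth.
- apply/rowP => k; rewrite !mxE !subrr expr0n /= addr0 !mul0r subr0.
  by move: k; apply: ord3_ind.
- move=> c q cq.
  (* The derivative of the quadratic term of [heis_coef] cancels the [e_0] component of the bracket
     of the rotation part with the frame. What remains of [lie_mx] has only the entries [l0 / 2] and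
     [- l0 / 2] at [(1, 2)] and [(2, 1)], so it is skew and the field is Killing. *)
  have ME i k : (lie_mx Q (heis_coef p) c q *m gram ones) i k =
    if k == o0 then 0 else - tau i k o0 / 2.
    rewrite mul_mx_diag !mxE mulr1 derive_heis_coef // !mxE sum3 !mxE.
    rewrite tau0 mulr0 add0r; move: k; apply: ord3_ind => /=.
    + by lra.
    + by rewrite !(tau_col i _ (k := o1)) // !mulr0 addr0 subr0.
    + by rewrite !(tau_col i _ (k := o2)) // !mulr0 addr0 subr0.
  apply/matrixP => i j; rewrite [LHS]mxE [X in _ + X]mxE !ME [RHS]mxE.
  move: i j; apply: ord3_ind; apply: ord3_ind; rewrite /= ?tauE ?l10 ?l20 /=; lra.
(* At [p], for the pair [(1, 2)], the two rotation components contribute [l0 / 2] each, matching the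
   [e_0] component [l0] of [[e_1, e_2]]. *)
- move=> c cp i j; rewrite !derive_heis_coef // !mxE !subrr /ones !mulr1 mul1r !mul0r add0r mul0r.
  move: i j; apply: ord3_ind; apply: ord3_ind; rewrite /= ?tauE ?l10 ?l20 /=; lra.
Qed.

End Cases.
End Dimension3.

Theorem mainTheorem1 (R : realType) (G : lieGroup R 3) (hG : unimodular G) :
  exists2 g : riemannianMetric G,
    left_invariant_metric g & forall p : G, (1 <= symmetry_index g p)%N.
Proof.
have adr_skew : skew_table (@adr R 3 G) by move=> i j; rewrite !row_adr opprB.
have [Q uQ [l0 [l1 [l2 [mil bal]]]]] := balanced_milnor_frame adr_skew (adr_trace hG).
have tau_skew : skew_table (@table R 3 G Q) by exact: skew_change_basis.
have [tau12 tau20 tau01] := milnor_change_basis uQ mil.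
case: bal => [[t0 [t1 [t2 [t0_gt0 t1_gt0 t2_gt0 lt]]]]|[_ l10 l20]].
  pose t (i : 'I_3) := if i == o0 then t0 else if i == o1 then t1 else t2.
  have t_gt0 i : 0 < t i by move: i; apply: ord3_ind.
  exists (frame_metric uQ (gram_sym t) (gram_posdef t_gt0)).
    exact: frame_metric_left_invariant.
  (* The metric is fixed before [p]; only the Killing field depends on [p]. *)
  by move=> p; apply: (right_invariant_case uQ tau_skew tau12 tau20 tau01).
have ones_gt0 i : 0 < @ones R i by exact: ltr01.
exists (frame_metric uQ (gram_sym (@ones R)) (gram_posdef ones_gt0)).
  exact: frame_metric_left_invariant.
by move=> p; apply: (heisenberg_case uQ tau_skew tau12 tau20 tau01).
Qed.
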